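(* Let $a,b\ge 3$ be integers. Then $$S^2([a^b])=[ab]+[ab-2,2]+[ab-3,3]+\cdots,\qquad A^2([a^b])=[ab-3,1^3]+\cdots,$$ where in both cases the dots stand for a sum of irreducible characters of depth at least $4$.
   Context: $(a^b)$ is the partition of $ab$ with $b$ parts equal to $a$. For a partition $\lambda$ of $n$, $[\lambda]$ denotes the irreducible complex character of the symmetric group $S_n$ labelled by $\lambda$; $[a^b]$ is the character labelled by $(a^b)$. For a character $\chi$ of a finite group, $S^2(\chi)(g)=\tfrac12(\chi(g)^2+\chi(g^2))$ and $A^2(\chi)(g)=\tfrac12(\chi(g)^2-\chi(g^2))$. The depth of $[\mu]$, for a partition $\mu$ of $n$, is $n-\mu_1$. *)

(* Defs.v *)
From HB Require Import structures.
From mathcomp Require Import all_boot all_order all_algebra.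
From mathcomp Require Import all_fingroup all_solvable all_field all_character.

Set Implicit Arguments.
Unset Strict Implicit.
Unset Printing Implicit Defensive.

Import GroupScope GRing.Theory.
Local Open Scope ring_scope.

Definition is_partition (n : nat) (la : seq nat) : bool :=
  [&& sorted geq la, 0%N \notin la & sumn la == n].

Definition depth (n : nat) (la : seq nat) : nat := (n - head 0%N la)%N.

Section SpechtCharacter.

Variables (n : nat) (la : seq nat).

(* 'I_n is identified with the Young diagram of la (la a partition of n) by
   filling the diagram row by row with 0, 1, ..., n-1: the number i is placed
   in row [reshape_index la i] and column [reshape_offset la i]. *)
Definition row_stab_set : {set 'S_n} :=
  [set s : 'S_n | [forall i, reshape_index la (s i) == reshape_index la i]].

Definition col_stab_set : {set 'S_n} :=
  [set s : 'S_n | [forall i, reshape_offset la (s i) == reshape_offset la i]].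

Fact row_stab_group_set : group_set row_stab_set.
Proof.
apply/group_setP; split=> [|s t].
  by rewrite inE; apply/forallP=> i; rewrite perm1.
rewrite !inE => /forallP Hs /forallP Ht; apply/forallP=> i.
by rewrite permM (eqP (Ht _)).
Qed.

Fact col_stab_group_set : group_set col_stab_set.
Proof.
apply/group_setP; split=> [|s t].
  by rewrite inE; apply/forallP=> i; rewrite perm1.
rewrite !inE => /forallP Hs /forallP Ht; apply/forallP=> i.
by rewrite permM (eqP (Ht _)).
Qed.

Definition row_stab : {group 'S_n} := Group row_stab_group_set.
Definition col_stab : {group 'S_n} := Group col_stab_group_set.

Fact sign_char_subproof :
  is_class_fun <<[set: 'S_n]>> [ffun s : 'S_n => (-1) ^+ odd_perm s : algC].
Proof.
apply: intro_class_fun => [s t _ _|s]; first by rewrite odd_permJ.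
by case/negP; rewrite mem_gen ?inE.
Qed.

Definition sign_char : 'CF([set: 'S_n]) := Cfun 0 sign_char_subproof.

(* The irreducible character [la] of S_n, as defined by James and Kerber: for a
   partition la of n, the permutation character on the cosets of the row
   stabiliser (a Young subgroup of type la) and the character induced from the
   sign character of the column stabiliser (a Young subgroup of type la') have
   exactly one irreducible constituent in common, and [la] is that one.  The
   default value 0 of [odflt] is thus never used when la is a partition of n. *)
Definition specht_char : 'CF([set: 'S_n]) :=
  'chi_(odflt 0 [pick i : Iirr [set: 'S_n] |
          (i \in irr_constt ('Ind[[set: 'S_n], row_stab] 1))
       && (i \in irr_constt ('Ind[[set: 'S_n], col_stab]
                               ('Res[col_stab] sign_char)))]).

End SpechtCharacter.

Section Squares.

Variables (gT : finGroupType) (G : {group gT}) (chi : 'CF(G)).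

(* Class functions on G vanish outside G, but chi (g ^+ 2) need not do so:
   hence the factors (g \in G)%:R. *)
Fact sym_square_subproof :
  is_class_fun <<G>> [ffun g => (g \in G)%:R * (2%:R^-1 *
     (chi g ^+ 2 + chi (g ^+ 2)%g)) : algC].
Proof.
rewrite genGid; apply: intro_class_fun => [g h Gg Gh|g /negbTE ->].
  by rewrite groupJr // -conjXg !cfunJ.
by rewrite mul0r.
Qed.

Fact alt_square_subproof :
  is_class_fun <<G>> [ffun g => (g \in G)%:R * (2%:R^-1 *
     (chi g ^+ 2 - chi (g ^+ 2)%g)) : algC].
Proof.
rewrite genGid; apply: intro_class_fun => [g h Gg Gh|g /negbTE ->].
  by rewrite groupJr // -conjXg !cfunJ.
by rewrite mul0r.
Qed.

Definition sym_square : 'CF(G) := Cfun 0 sym_square_subproof.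
Definition alt_square : 'CF(G) := Cfun 0 alt_square_subproof.

End Squares.

(* A (possibly empty) sum of irreducible characters of S_n, with repetitions
   allowed, all of them of depth at least d. *)
Definition sum_of_depth_ge (n d : nat) (phi : 'CF([set: 'S_n])) : Prop :=
  exists2 L : seq (seq nat),
    all (fun mu => is_partition n mu && (d <= depth n mu)%N) L
    & phi = \sum_(mu <- L) specht_char n mu.

(* Main.v *)
Require Import Defs.
From mathcomp Require Import all_boot all_order all_algebra.
From mathcomp Require Import all_fingroup all_solvable all_field all_character.
From mathcomp Require Import zify ring.

(** The idea is to count constituents by restricting to the subgroups
    S_(n-k) x S_k with k <= 3.  Let chi be the character of the rectangle.
    Restricted to S_(n-3) x S_3, it is multiplicity free: the sum, over the
    partitions al of 3, of [P_al] x [al], where P_al is the rectangle with al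
    removed from its corner, after a rotation of al by half a turn.  As the
    characters of symmetric groups are real with Frobenius-Schur indicator 1, the
    invariants of S_(n-3) in the symmetric and the alternating square of chi form
    the sums of the symmetric and of the alternating squares of the [al], that is
    3 [3] + [2,1] and [1^3].  Likewise for k = 2 one finds 2 [2] and 0, for k = 1
    the trivial character and 0.  Pairing with permutation characters of Young
    subgroups S_mu, where mu has depth at most 3, gives the scalar products of
    the two squares with seven permutation characters ([rect_equation0] to
    [rect_equations3]); the matrix of Kostka numbers is unitriangular and the
    solution is the announced one ([sym_square_rect], [alt_square_rect]).

    What this needs on the characters of symmetric groups is obtained from the
    formula of Frobenius.  For v of length l the class function [frob v] is the
    alternating sum of Jacobi and Trudi, written as a sum over the words fixed by
    a permutation; it alternates in v, and its restriction to a Young subgroup is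
    immediate on words ([frob_psum]).  This yields the rule of Murnaghan and
    Nakayama for the products of cycles of length at most 3 that occur here
    ([hook1_rect] to [hook3_rect]), and, after a cancellation of terms, the rule
    of Pieri ([pieri]).  The latter implies that the average of [frob v] over the
    row stabiliser of mu vanishes unless the shape of v dominates mu
    ([row_avg_cells]) and is 1 when they agree ([row_avg_frob_diag]).  Expanding
    one factor of the norm of [frob v] then leaves a single term, so that
    [frob v] is an irreducible character ([frob_irr]).

    Conversely every irreducible character is of this form ([irr_frob]), because
    it occurs in the permutation character on the cosets of the trivial group,
    and that one is a combination of the functions [frob v].  The character
    labelled by nu is thus the function attached to some shape; it occurs in the
    permutation character of the row stabiliser of nu, and in the signed one of
    the column stabiliser.  The first property makes the shape dominate nu, the
    second one makes nu dominate the shape ([specht_frob_shape]).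

    The indicator is 1 because the trivial character of the row stabiliser occurs
    once in the restriction: the idempotent E that averages over that subgroup
    has rank 1, and the indicator is a positive multiple of the sum of the
    squares of the real numbers tr (g E) ([frobenius_schur_gt0]).  That the
    squares are characters, so that the multiplicities are natural numbers,
    comes from the action of the group on bilinear forms
    ([sym_square_char], [alt_square_char]). *)

Set Implicit Arguments.
Unset Strict Implicit.
Unset Printing Implicit Defensive.

Import GroupScope Order.TTheory GRing.Theory Num.Theory.
Local Open Scope ring_scope.

(** * Permutations of two blocks and row stabilisers *)

Section PermSum.

Variables m k : nat.

Definition psum_fun (x : 'S_m) (y : 'S_k) (i : 'I_(m + k)) : 'I_(m + k) :=
  unsplit (match split i with inl j => inl (x j) | inr j => inr (y j) end).

Fact psum_inj x y : injective (psum_fun x y).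
Proof.
move=> i j /(can_inj unsplitK) eq_ij; apply: (can_inj splitK).
by case: (split i) (split j) eq_ij => [i'|i'] [j'|j'] // [] /perm_inj ->.
Qed.

Definition psum x y : 'S_(m + k) := perm (@psum_inj x y).

Lemma psum_lshift x y i : psum x y (lshift k i) = lshift k (x i).
Proof. by rewrite permE /psum_fun (unsplitK (inl i)). Qed.

Lemma psum_rshift x y i : psum x y (rshift m i) = rshift m (y i).
Proof. by rewrite permE /psum_fun (unsplitK (inr i)). Qed.

Lemma psumM x x' y y' : (psum x y * psum x' y' = psum (x * x') (y * y'))%g.
Proof.
apply/permP=> i; rewrite permM; case: (split_ordP i) => j ->.
  by rewrite !psum_lshift permM.
by rewrite !psum_rshift permM.
Qed.

Lemma psum_sqr x y : (psum x y ^+ 2 = psum (x ^+ 2) (y ^+ 2))%g.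
Proof. by rewrite !expgS !expg0 !mulg1 psumM. Qed.

Lemma psum_injective : injective (fun p : 'S_m * 'S_k => psum p.1 p.2).
Proof.
move=> [x y] [x' y'] /= /permP eq_xy; congr (_, _); apply/permP=> i.
  by have:= eq_xy (lshift k i); rewrite !psum_lshift => /lshift_inj.
by have:= eq_xy (rshift m i); rewrite !psum_rshift => /rshift_inj.
Qed.

(** By finiteness, a permutation that maps the first block into itself also
    preserves the second one. *)
Lemma psumP (g : 'S_(m + k)) :
  (forall i : 'I_m, (g (lshift k i) < m)%N) ->
  exists x : 'S_m, exists y : 'S_k, g = psum x y.
Proof.
move=> gm.
pose f i := Ordinal (gm i).
have f_inj : injective f.
  move=> i j /(congr1 val) /= /val_inj /perm_inj.
  exact: lshift_inj.
have gf i : g (lshift k i) = lshift k (perm f_inj i).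
  by apply: val_inj; rewrite /= permE.
have gk (j : 'I_k) : (m <= g (rshift m j))%N.
  rewrite leqNgt; apply/negP=> lt_m.
  have [i def_i] : exists i, perm f_inj i = Ordinal lt_m.
    by exists ((perm f_inj)^-1%g (Ordinal lt_m)); rewrite permKV.
  have /perm_inj/eqP : g (lshift k i) = g (rshift m j).
    by rewrite gf def_i; apply: val_inj.
  by rewrite eq_lrshift.
have gk' (j : 'I_k) : (g (rshift m j) - m < k)%N.
  by rewrite ltn_subLR ?gk ?ltn_ord.
pose h j := Ordinal (gk' j).
have h_inj : injective h.
  move=> i j /(congr1 val) /= eq_ij.
  have: val (g (rshift m i)) = val (g (rshift m j)).
    by rewrite /= -(subnK (gk i)) -(subnK (gk j)) eq_ij.
  by move/val_inj/perm_inj/rshift_inj.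
exists (perm f_inj), (perm h_inj); apply/permP=> i.
case: (split_ordP i) => j ->; first by rewrite psum_lshift gf.
by rewrite psum_rshift; apply: val_inj; rewrite /= permE /= subnKC.
Qed.

End PermSum.

Lemma row_stabE n la (s : 'S_n) :
  (s \in row_stab n la)
    = [forall i, reshape_index la (s i) == reshape_index la i].
Proof. by rewrite inE. Qed.

Lemma reshape_index_cons k la i :
  reshape_index (k :: la) i = if (i < k)%N then 0%N
                              else (reshape_index la (i - k)).+1.
Proof.
rewrite /reshape_index /= subn_eq0; case: ltnP => //= le_ki.
by rewrite subSn.
Qed.

Lemma reshape_offset_cons k la i :
  reshape_offset (k :: la) i = if (i < k)%N then i
                               else reshape_offset la (i - k).
Proof.
rewrite /reshape_offset reshape_index_cons; case: ltnP => _ /=.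
  by rewrite subn0.
by rewrite subnDA.
Qed.

(** The first row is the first block of integers, and the row stabiliser
    preserves it. *)
Lemma row_stab_consP k m la (g : 'S_(k + m)) :
  reflect (exists2 p : 'S_k * 'S_m, p.2 \in row_stab m la & g = psum p.1 p.2)
          (g \in row_stab (k + m) (k :: la)).
Proof.
apply: (iffP idP) => [|[[y x] /= Rx ->]].
  rewrite row_stabE => /forallP Rg.
  have [i|y [x def_g]] := @psumP k m g.
    have:= Rg (lshift m i); rewrite !reshape_index_cons /= ltn_ord.
    by case: ifP.
  exists (y, x) => //=; rewrite row_stabE; apply/forallP=> i.
  have:= Rg (rshift k i); rewrite def_g psum_rshift !reshape_index_cons /=.
  by rewrite !ltnNge !leq_addr /= eqSS !addKn.
rewrite row_stabE; apply/forallP=> i; case: (split_ordP i) => j ->.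
  by rewrite psum_lshift !reshape_index_cons /= !ltn_ord.
rewrite psum_rshift !reshape_index_cons /= !ltnNge !leq_addr /= eqSS !addKn.
by move: Rx; rewrite row_stabE => /forallP.
Qed.

Lemma sum_row_stab_cons k m la (F : 'S_(k + m) -> algC) :
  \sum_(g in row_stab (k + m) (k :: la)) F g
    = \sum_(y : 'S_k) \sum_(x in row_stab m la) F (psum y x).
Proof.
rewrite pair_big_dep /=.
rewrite (reindex_onto (fun p : 'S_k * 'S_m => psum p.1 p.2)
   (fun g => odflt (1%g, 1%g) [pick p : 'S_k * 'S_m | psum p.1 p.2 == g])) /=.
  apply: eq_bigl => -[y x] /=.
  case: pickP => [[y' x'] /= /eqP/(@psum_injective _ _ (y', x') (y, x)) eq_p | none].
    rewrite eq_p eqxx andbT; apply/row_stab_consP/idP => [[[z t] /= Rt]|Rx].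
      by move/(@psum_injective _ _ (y, x) (z, t)) => [_ ->].
    by exists (y, x).
  by have:= none (y, x); rewrite eqxx.
move=> g /row_stab_consP [p Rp ->]; case: pickP => [q /eqP //|none].
by have:= none p; rewrite eqxx.
Qed.

Lemma card_row_stab_cons k m la :
  #|row_stab (k + m) (k :: la)|%:R
    = k`!%:R * #|row_stab m la|%:R :> algC.
Proof.
have cardE (gT : finGroupType) (A : {set gT}) :
    #|A|%:R = \sum_(g in A) 1 :> algC by rewrite sumr_const.
rewrite !cardE sum_row_stab_cons mulr_sumr [LHS]exchange_big /=.
by apply: eq_bigr => x _; rewrite sumr_const card_Sn mulr1.
Qed.

Lemma row_stab_nil (s : 'S_0) : s \in row_stab 0 [::].
Proof. by rewrite row_stabE; apply/forallP=> -[]. Qed.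

(** * The class functions of Frobenius *)

Definition content k l (d : {ffun 'I_k -> 'I_l}) (i : 'I_l) : nat :=
  \sum_x (d x == i).

Definition fixes k l (g : 'S_k) (d : {ffun 'I_k -> 'I_l}) : bool :=
  [forall x, d (g x) == d x].

(** The sign of [w] if [u] is the image of the staircase [l-1, ..., 1, 0] by the
    permutation [w], and 0 if there is no such [w]. *)
Definition staircase_det l (u : 'I_l -> int) : algC :=
  \det (\matrix_(i, j) (u i == (rev_ord j)%:Z)%:R).

(** The formula of Frobenius.  Expanding the determinant turns [frob] into the
    alternating sum, over the permutations [w], of the numbers of words fixed by
    [g] with content [v - w(staircase)]: for [v] the sum of a partition and of
    the staircase, these are the terms of the determinant of Jacobi and Trudi. *)
Definition frob k l (v : 'I_l -> int) (g : 'S_k) : algC :=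
  \sum_(d : {ffun 'I_k -> 'I_l} | fixes g d)
     staircase_det (fun i => v i - (content d i)%:Z).

Definition alternating l (F : ('I_l -> int) -> algC) : Prop :=
  (forall u u', u =1 u' -> F u = F u') /\
  (forall (s : 'S_l) u, F (fun i => u (s i)) = (-1) ^+ s * F u).

Lemma alternating_eq0 l (F : ('I_l -> int) -> algC) u i j :
  alternating F -> i != j -> u i = u j -> F u = 0.
Proof.
move=> [Fext Falt] neq_ij eq_u; have := Falt (tperm i j) u.
rewrite odd_tperm neq_ij expr1 mulN1r (Fext _ u) => [|x]; last first.
  by case: tpermP => [->|->|].
move/eqP; rewrite -subr_eq0 opprK -mulr2n mulrn_eq0 /= => /eqP //.
Qed.

Lemma alternating_swap l (F : ('I_l -> int) -> algC) u i j :
  alternating F -> i != j -> F (fun x => u (tperm i j x)) = - F u.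
Proof. by move=> [_ ->] neq_ij; rewrite odd_tperm neq_ij expr1 mulN1r. Qed.

Lemma staircase_det_alternating l : alternating (@staircase_det l).
Proof.
split=> [u u' eq_u|s u].
  by congr (\det _); apply/matrixP=> i j; rewrite !mxE eq_u.
rewrite /staircase_det -det_perm -det_mulmx -row_permE; congr (\det _).
by apply/matrixP=> i j; rewrite !mxE.
Qed.

Lemma staircase_det_neq0 l (u : 'I_l -> int) :
  staircase_det u != 0 -> exists w : 'S_l, forall i, u i = (rev_ord (w i))%:Z.
Proof.
move=> nz; have [w /forallP Pw|no_w] :=
    pickP (fun w : 'S_l => [forall i, u i == (rev_ord (w i))%:Z]).
  by exists w => i; apply/eqP.
case/eqP: nz; apply: big1 => w _; have/negbT := no_w w.
rewrite negb_forall => /existsP [i /negbTE ne_i].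
by rewrite (bigD1 i) //= mxE ne_i mul0r mulr0.
Qed.

Lemma staircase_det1 l : staircase_det (fun i : 'I_l => (rev_ord i)%:Z) = 1.
Proof.
rewrite /staircase_det -[RHS](det1 _ l); congr (\det _); apply/matrixP=> i j.
by rewrite !mxE eqz_nat (inj_eq val_inj) (inj_eq rev_ord_inj).
Qed.

Lemma staircase_det_real l (u : 'I_l -> int) :
  (staircase_det u)^* = staircase_det u.
Proof.
rewrite /staircase_det -det_map_mx; congr (\det _); apply/matrixP=> i j.
by rewrite !mxE rmorph_nat.
Qed.

Lemma sum_content k l (d : {ffun 'I_k -> 'I_l}) :
  (\sum_i content d i)%N = k.
Proof.
rewrite exchange_big /= -[RHS]card_ord -sum1_card; apply: eq_bigr => x _.
by rewrite (bigD1 (d x)) //= eqxx big1 // => i /negbTE; rewrite eq_sym => ->.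
Qed.

Lemma content_perm k l (s : 'S_l) (d : {ffun 'I_k -> 'I_l}) i :
  content [ffun x => s (d x)] (s i) = content d i.
Proof.
by apply: eq_bigr => x _; rewrite ffunE (inj_eq perm_inj).
Qed.

Lemma content_comp k l (g : 'S_k) (d : {ffun 'I_k -> 'I_l}) :
  content [ffun x => d (g x)] =1 content d.
Proof.
move=> i; rewrite /content [RHS](reindex_inj (@perm_inj _ g)).
by apply: eq_bigr => x _; rewrite ffunE.
Qed.

Lemma perm_ffun_bij k l (s : 'S_l) :
  bijective (fun d : {ffun 'I_k -> 'I_l} => [ffun x => s (d x)]).
Proof.
by exists (fun d : {ffun 'I_k -> 'I_l} => [ffun x => (s^-1)%g (d x)]) => d;
  apply/ffunP=> x; rewrite !ffunE (permK, permKV).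
Qed.

Lemma comp_ffun_bij k l (g : 'S_k) :
  bijective (fun d : {ffun 'I_k -> 'I_l} => [ffun x => d (g x)]).
Proof.
by exists (fun d : {ffun 'I_k -> 'I_l} => [ffun x => d (g^-1 x)%g]) => d;
  apply/ffunP=> x; rewrite !ffunE (permK, permKV).
Qed.

Lemma frob_alternating k l (g : 'S_k) : alternating (fun v => @frob k l v g).
Proof.
have [Dext Dalt] := staircase_det_alternating l.
split=> [v v' eq_v|s v].
  by apply: eq_bigr => d _; apply: Dext => i; rewrite eq_v.
rewrite /frob mulr_sumr.
rewrite [RHS](reindex _ (onW_bij _ (perm_ffun_bij k s))) /=.
apply: eq_big => [d|d _].
  by apply: eq_forallb => x; rewrite !ffunE (inj_eq perm_inj).
by rewrite -Dalt; apply: Dext => i; rewrite content_perm.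
Qed.

Lemma frobJ k l (v : 'I_l -> int) (g h : 'S_k) : frob v (g ^ h)%g = frob v g.
Proof.
have [Dext _] := staircase_det_alternating l.
rewrite /frob [RHS](reindex _ (onW_bij _ (comp_ffun_bij l h))) /=.
apply: eq_big => [d|d _]; last first.
  by apply: Dext => i; rewrite content_comp.
apply/forallP/forallP=> gd x.
  by have:= gd (h x); rewrite !ffunE conjgE !permM permK.
have:= gd (h^-1 x)%g; rewrite !ffunE permKV => /eqP <-.
by rewrite conjgE !permM.
Qed.

Lemma frob_real k l (v : 'I_l -> int) (g : 'S_k) : (frob v g)^* = frob v g.
Proof.
by rewrite /frob rmorph_sum /=; apply: eq_bigr => d _; apply: staircase_det_real.
Qed.

Lemma frob_neg k l (v : 'I_l -> int) (g : 'S_k) i : v i < 0 -> frob v g = 0.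
Proof.
move=> v_neg; apply: big1 => d _; apply/eqP/contraT=> /staircase_det_neq0 [w].
by move/(_ i); lia.
Qed.

Lemma frob0 l (v : 'I_l -> int) (g : 'S_0) : frob v g = staircase_det v.
Proof.
have [Dext _] := staircase_det_alternating l.
have eq_d (d d' : {ffun 'I_0 -> 'I_l}) : d = d' by apply/ffunP=> -[].
pose d0 : {ffun 'I_0 -> 'I_l} := ffun0 (card_ord 0).
rewrite /frob (bigD1 d0) /=; last by apply/forallP=> -[].
rewrite big1 => [|d]; last by rewrite (eq_d d d0) eqxx andbF.
by rewrite addr0; apply: Dext => i; rewrite /content big_ord0 subr0.
Qed.

Section FrobSum.

Variables m k l : nat.

Definition cat_word (d : {ffun 'I_m -> 'I_l}) (d' : {ffun 'I_k -> 'I_l}) :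
  {ffun 'I_(m + k) -> 'I_l} :=
  [ffun x : 'I_(m + k) => match split x with inl i => d i | inr i => d' i end].

Lemma cat_word_l d d' i : cat_word d d' (lshift k i) = d i.
Proof. by rewrite ffunE (unsplitK (inl i)). Qed.

Lemma cat_word_r d d' i : cat_word d d' (rshift m i) = d' i.
Proof. by rewrite ffunE (unsplitK (inr i)). Qed.

Lemma cat_word_bij :
  bijective (fun p : {ffun 'I_m -> 'I_l} * {ffun 'I_k -> 'I_l} =>
               cat_word p.1 p.2).
Proof.
exists (fun d : {ffun 'I_(m + k) -> 'I_l} =>
          ([ffun i => d (lshift k i)], [ffun i => d (rshift m i)])).
  by case=> d d'; congr (_, _); apply/ffunP=> i;
    rewrite ffunE (cat_word_l, cat_word_r).
move=> d; apply/ffunP=> x; case: (split_ordP x) => i ->;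
  by rewrite (cat_word_l, cat_word_r) ffunE.
Qed.

Lemma content_cat d d' i :
  content (cat_word d d') i = (content d i + content d' i)%N.
Proof.
by rewrite /content big_split_ord /=; congr (_ + _)%N; apply: eq_bigr => x _;
  rewrite (cat_word_l, cat_word_r).
Qed.

Lemma fixes_cat (x : 'S_m) (y : 'S_k) d d' :
  fixes (psum x y) (cat_word d d') = fixes x d && fixes y d'.
Proof.
apply/forallP/andP=> [xyd|[/forallP xd /forallP yd] i].
  split; apply/forallP=> i.
    by have:= xyd (lshift k i); rewrite psum_lshift !cat_word_l.
  by have:= xyd (rshift m i); rewrite psum_rshift !cat_word_r.
case: (split_ordP i) => j ->.
  by rewrite psum_lshift !cat_word_l.
by rewrite psum_rshift !cat_word_r.
Qed.

(** A word fixed by [psum x y] is a pair of words fixed by [x] and by [y], and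
    the contents add up: restriction to a Young subgroup subtracts a content
    from [v]. *)
Lemma frob_psum (v : 'I_l -> int) (x : 'S_m) (y : 'S_k) :
  frob v (psum x y) = \sum_(d : {ffun 'I_k -> 'I_l} | fixes y d)
                         frob (fun i => v i - (content d i)%:Z) x.
Proof.
have [Dext _] := staircase_det_alternating l.
rewrite /frob (reindex _ (onW_bij _ cat_word_bij)) /=.
rewrite [RHS]exchange_big /= [RHS]pair_big /=.
apply: eq_big => [p|p _]; first by rewrite fixes_cat.
by apply: Dext => i; rewrite content_cat PoszD; ring.
Qed.

Lemma frob_psum_l (v : 'I_l -> int) (x : 'S_m) (y : 'S_k) :
  frob v (psum x y) = \sum_(d : {ffun 'I_m -> 'I_l} | fixes x d)
                         frob (fun i => v i - (content d i)%:Z) y.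
Proof.
have [Dext _] := staircase_det_alternating l.
rewrite /frob (reindex _ (onW_bij _ cat_word_bij)) /=.
rewrite [RHS]pair_big /=.
apply: eq_big => [p|p _]; first by rewrite fixes_cat.
by apply: Dext => i; rewrite content_cat PoszD; ring.
Qed.

End FrobSum.

(** * Words and averages over row stabilisers *)

(** For a class function [phi], its scalar product with the permutation
    character on the cosets of the row stabiliser. *)
Definition row_avg n (mu : seq nat) (phi : 'S_n -> algC) : algC :=
  #|row_stab n mu|%:R^-1 * \sum_(g in row_stab n mu) phi g.

Lemma count_rows la r :
  (\sum_(i < sumn la) (reshape_index la i == r))%N = nth 0%N la r.
Proof.
elim: la r => [|k la IHla] r /=; first by rewrite big_ord0 nth_nil.
rewrite big_split_ord /=.
under eq_bigr do rewrite reshape_index_cons ltn_ord.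
under [X in (_ + X)%N]eq_bigr do
  rewrite reshape_index_cons ltnNge leq_addr /= addKn.
case: r => [|r] /=; last by rewrite big1 //= -IHla.
by rewrite sum1_card card_ord big1 ?addn0.
Qed.

Lemma word_transitive n l (d d0 : {ffun 'I_n -> 'I_l}) :
  content d =1 content d0 -> exists t : 'S_n, forall x, d x = d0 (t x).
Proof.
move=> eq_c.
have /tuple_permP [t def_t] : perm_eq [tuple d i | i < n] [tuple d0 i | i < n].
  have cnt (e : {ffun 'I_n -> 'I_l}) j :
      count_mem j [tuple e i | i < n] = content e j.
    by rewrite /= /content count_map -sum1_count big_mkcond /= big_enum.
  by apply/allP=> j _; apply/eqP; rewrite /= !cnt.
exists t => x; have /(congr1 (fun s => nth (d0 x) s x)) := def_t.
by rewrite -!tnth_nth !tnth_mktuple.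
Qed.

(** Both sides sum [phi] over the pairs made of a word and of a permutation
    fixing it: the words with prescribed content are the rearrangements of the
    word that reads off the rows of the diagram, and the stabiliser of the latter
    is the row stabiliser. *)
Lemma sum_words_content l n (al : seq nat) (phi : 'S_n -> algC) :
    size al = l -> sumn al = n ->
    (forall g h, phi (g ^ h)%g = phi g) ->
  \sum_(d : {ffun 'I_n -> 'I_l} | [forall i, content d i == nth 0%N al i])
     \sum_(g | fixes g d) phi g
  = n`!%:R * row_avg al phi.
Proof.
move=> size_al sum_al phiJ.
have ltd (i : 'I_n) : (reshape_index al i < l)%N.
  by rewrite -size_al reshape_indexP ?sum_al.
pose d0 : {ffun 'I_n -> 'I_l} := [ffun i => Ordinal (ltd i)].
have fix0 g : fixes g d0 = (g \in row_stab n al).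
  rewrite row_stabE; apply: eq_forallb => i.
  by rewrite !ffunE -val_eqE.
have cont0 i : content d0 i = nth 0%N al i.
  rewrite -count_rows sum_al.
  by apply: eq_bigr => x _; rewrite ffunE -val_eqE.
pose w t : {ffun 'I_n -> 'I_l} := [ffun x => d0 ((t : 'S_n) x)].
have cont_w t : content (w t) =1 content d0 by apply: content_comp.
pose F (d : {ffun 'I_n -> 'I_l}) := \sum_(g | fixes g d) phi g.
have Fw t : F (w t) = F d0.
  rewrite /F (reindex_inj (conjg_inj (t^-1)%g)) /=; apply: eq_big => g.
    apply/forallP/forallP=> gd x.
      have:= gd ((t^-1)%g x); rewrite !ffunE conjgE invgK !permM.
      by rewrite permKV permKV.
    have:= gd (t x); rewrite !ffunE conjgE invgK !permM permKV; exact.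
  by move=> _; rewrite phiJ.
have sumF : \sum_(t : 'S_n) F (w t) = n`!%:R * F d0.
  under eq_bigr do rewrite Fw.
  by rewrite sumr_const card_Sn mulr_natl.
have fib (d : {ffun 'I_n -> 'I_l}) : [forall i, content d i == nth 0%N al i] ->
    #|[pred t : 'S_n | w t == d]| = #|row_stab n al|.
  move/forallP=> cont_d.
  have [t1 def_d] : exists t : 'S_n, forall x, d x = d0 (t x).
    by apply: word_transitive => i; rewrite cont0; apply/eqP.
  rewrite -[RHS](card_imset _ (mulgI t1)); apply: eq_card => t.
  rewrite !inE; apply/eqP/imsetP=> [def_t|[s Rs ->]].
    exists (t1^-1 * t)%g; last by rewrite mulKVg.
    rewrite -fix0; apply/forallP=> x; move/ffunP/(_ ((t1^-1)%g x)): def_t.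
    by rewrite ffunE def_d permM permKV => ->.
  apply/ffunP=> x; rewrite !def_d ffunE permM; apply/eqP.
  by move: Rs; rewrite -fix0 => /forallP.
have R_neq0 : #|row_stab n al|%:R != 0 :> algC.
  by rewrite pnatr_eq0 -lt0n cardG_gt0.
apply: (mulfI R_neq0).
have sumR : \sum_(g in row_stab n al) phi g = F d0.
  by apply: eq_bigl => g; rewrite fix0.
rewrite /row_avg mulrCA mulVKf // sumR -sumF.
rewrite mulr_sumr [RHS](partition_big w
  (fun d => [forall i, content d i == nth 0%N al i])) /= => [|t _]; last first.
  by apply/forallP=> i; rewrite cont_w cont0.
apply: eq_bigr => d cont_d; rewrite [RHS](eq_bigr (fun=> F d)) => [|t /eqP-> //].
transitivity (F d *+ #|[pred t : 'S_n | w t == d]|).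
  by rewrite (fib d cont_d) mulr_natl.
by rewrite -sumr_const; apply: eq_bigl.
Qed.

Lemma row_avg_cons k m mu (phi : 'S_(k + m) -> algC) :
  row_avg (k :: mu) phi
    = k`!%:R^-1 * \sum_(y : 'S_k) row_avg mu (fun x => phi (psum y x)).
Proof.
rewrite /row_avg card_row_stab_cons sum_row_stab_cons invfM -mulrA.
by congr (_ * _); rewrite mulr_sumr.
Qed.

Lemma row_avg_nil (phi : 'S_0 -> algC) : row_avg [::] phi = phi 1%g.
Proof.
have eq1 (g : 'S_0) : g = 1%g by apply/permP=> -[].
have R1 : row_stab 0 [::] = 1%g :> {set 'S_0}.
  by apply/setP=> g; rewrite row_stab_nil (eq1 g) inE eqxx.
by rewrite /row_avg R1 cards1 invr1 mul1r big_set1.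
Qed.

Lemma row_avg_alternating n l mu :
  alternating (fun v : 'I_l -> int => row_avg mu (@frob n l v)).
Proof.
split=> [u u' eq_u|s u]; rewrite /row_avg.
  by congr (_ * _); apply: eq_bigr => g _; apply: (frob_alternating _ g).1.
rewrite mulrCA; congr (_ * _); rewrite mulr_sumr; apply: eq_bigr => g _.
exact: (frob_alternating _ g).2.
Qed.

Lemma row_avg_sum n mu I (r : seq I) P (F : I -> 'S_n -> algC) :
  row_avg mu (fun g => \sum_(i <- r | P i) F i g)
    = \sum_(i <- r | P i) row_avg mu (F i).
Proof. by rewrite /row_avg exchange_big mulr_sumr. Qed.

Lemma row_avg_scale n mu c (phi : 'S_n -> algC) :
  row_avg mu (fun g => c * phi g) = c * row_avg mu phi.
Proof. by rewrite /row_avg -mulr_sumr mulrCA. Qed.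

Lemma eq_row_avg n mu (phi psi : 'S_n -> algC) :
  phi =1 psi -> row_avg mu phi = row_avg mu psi.
Proof. by move=> eq_phi; congr (_ * _); apply: eq_bigr. Qed.

Definition content_ffun k l (be : {ffun 'I_l -> 'I_k.+1}) : seq nat :=
  [seq val (be i) | i <- enum 'I_l].

Lemma content_bound k l (d : {ffun 'I_k -> 'I_l}) i : (content d i < k.+1)%N.
Proof. by rewrite ltnS -[X in (_ <= X)%N](sum_content d) (bigD1 i) //= leq_addr. Qed.

(** Exchange the two sums and group the words by content. *)
Lemma sum_words n l (G : ('I_l -> nat) -> algC) (phi : 'S_n -> algC) :
    (forall g h, phi (g ^ h)%g = phi g) ->
    (forall c c', c =1 c' -> G c = G c') ->
  n`!%:R^-1 * \sum_(g : 'S_n) phi g *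
      (\sum_(d : {ffun 'I_n -> 'I_l} | fixes g d) G (content d))
  = \sum_(al : {ffun 'I_l -> 'I_n.+1} | (\sum_i al i)%N == n)
       G (fun i => al i) * row_avg (content_ffun al) phi.
Proof.
move=> phiJ Gext.
under eq_bigr do rewrite mulr_sumr.
rewrite (exchange_big_dep xpredT) //= mulr_sumr.
pose p (d : {ffun 'I_n -> 'I_l}) := [ffun i => Ordinal (content_bound d i)].
rewrite (partition_big p (fun al => (\sum_i al i)%N == n)) /= => [|d _].
  apply: eq_bigr => al /eqP sum_al.
  transitivity (n`!%:R^-1 * (G (fun i => al i) *
     \sum_(d : {ffun 'I_n -> 'I_l} | [forall i, content d i == al i])
        \sum_(g | fixes g d) phi g)).
    rewrite !mulr_sumr; apply: eq_big => [d|d].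
      apply/eqP/forallP=> [<- i|eq_d]; first by rewrite ffunE.
      by apply/ffunP=> i; apply/val_inj/eqP; rewrite ffunE; apply: eq_d.
    move/eqP=> def_al; congr (_ * _); rewrite mulr_sumr.
    apply: eq_bigr => g _; rewrite mulrC; congr (_ * _).
    by apply: Gext => i; rewrite -def_al ffunE.
  rewrite mulrCA; congr (_ * _).
  have def_al (i : 'I_l) : nth 0%N (content_ffun al) i = al i.
    by rewrite (nth_map i) ?size_enum_ord // nth_ord_enum.
  apply: (canLR (mulKf _)); first by rewrite pnatr_eq0 -lt0n fact_gt0.
  rewrite -(@sum_words_content l) //.
  - by apply: eq_bigl => d; apply: eq_forallb => i; rewrite def_al.
  - by rewrite size_map size_enum_ord.
  - by rewrite sumnE big_map big_enum.
apply/eqP; rewrite -[RHS](sum_content d).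
by apply: eq_bigr => i _; rewrite ffunE.
Qed.

(** * The rule of Pieri *)

Lemma row_avg_const n mu (c : algC) : row_avg mu (fun _ : 'S_n => c) = c.
Proof.
rewrite /row_avg sumr_const -[c *+ _]mulr_natl mulKf //.
by rewrite pnatr_eq0 -lt0n cardG_gt0.
Qed.

(** Averaging over the first factor of the row stabiliser makes every content of
    size [k] count once. *)
Lemma row_avg_frob_cons k m l mu (v : 'I_l -> int) :
  row_avg (k :: mu) (@frob (k + m) l v)
    = \sum_(al : {ffun 'I_l -> 'I_k.+1} | (\sum_i al i)%N == k)
        row_avg mu (@frob m l (fun i => v i - (al i)%:Z)).
Proof.
rewrite row_avg_cons.
pose G c := row_avg mu (@frob m l (fun i => v i - (c i)%:Z)).
have Gext c c' : c =1 c' -> G c = G c'.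
  by move=> eq_c; apply: (row_avg_alternating _ _ _).1 => i; rewrite eq_c.
have /= := @sum_words k l G (fun=> 1) (fun _ _ => erefl) Gext.
under [RHS]eq_bigr do rewrite row_avg_const mulr1.
move=> <-; congr (_ * _); apply: eq_bigr => y _.
by rewrite mul1r -row_avg_sum; apply: eq_row_avg => x; rewrite frob_psum_l.
Qed.

Section Pieri.

Variables (l k N : nat) (v : 'I_l -> nat).
Variable F : ('I_l -> int) -> algC.
Hypothesis v_bound : forall i, (v i < N.+1)%N.
Hypothesis v_decr : forall i j : 'I_l, (i < j)%N -> (v j < v i)%N.
Hypothesis F_alt : alternating F.
Hypothesis F_neg : forall u i, u i < 0 -> F u = 0.

Let box (ga : {ffun 'I_l -> 'I_N.+1}) :=
  [forall i, ga i <= v i]%N && (\sum_i ga i + k == \sum_i v i)%N.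

(** What is removed from [v] to get [ga] fails to be a horizontal strip at row
    [i]: the new row [i] is shorter than the old row [i.+1]. *)
Definition breaks_strip (ga : {ffun 'I_l -> 'I_N.+1}) (i : 'I_l) :=
  [exists j : 'I_l, (j == i.+1 :> nat) && (ga i <= v j)%N].

Let evalF (ga : {ffun 'I_l -> 'I_N.+1}) := F (fun i => (ga i)%:Z).

Lemma sum_removals :
  \sum_(al : {ffun 'I_l -> 'I_k.+1} | (\sum_i al i)%N == k)
      F (fun i => (v i)%:Z - (al i)%:Z)
    = \sum_(ga | box ga) evalF ga.
Proof.
rewrite (bigID (fun al : {ffun 'I_l -> 'I_k.+1} => [forall i, al i <= v i]%N)) /=.
rewrite addrC big1 ?add0r => [|al /andP [_]]; last first.
  by rewrite negb_forall => /existsP [i lt_v]; apply: (F_neg (i := i)); lia.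
pose h (ga : {ffun 'I_l -> 'I_N.+1}) : {ffun 'I_l -> 'I_k.+1} :=
  [ffun i => inord (v i - ga i)].
pose h' (al : {ffun 'I_l -> 'I_k.+1}) : {ffun 'I_l -> 'I_N.+1} :=
  [ffun i => inord (v i - al i)].
have h'E al i : h' al i = (v i - al i)%N :> nat.
  by rewrite ffunE inordK // (leq_ltn_trans (leq_subr _ _)).
rewrite (reindex_onto h h') /= => [|al /andP [_ /forallP le_al]]; last first.
  by apply/ffunP=> i; rewrite ffunE h'E subKn // inord_val.
have hE ga : box ga -> forall i, h ga i = (v i - ga i)%N :> nat.
  case/andP=> /forallP le_ga /eqP sum_ga i; rewrite ffunE inordK // ltnS.
  have -> : k = (\sum_j (v j - ga j))%N.
    apply/eqP; rewrite -(eqn_add2l (\sum_i0 ga i0)) sum_ga -big_split /=.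
    by apply/eqP/eq_bigr => j _; rewrite subnKC.
  by rewrite (bigD1 i) //= leq_addr.
apply: eq_big => [ga|ga].
  apply/andP/idP=> [[/andP [/eqP sum_h /forallP le_h] /eqP def_ga]|Bga].
    have gaE i : ga i = (v i - h ga i)%N :> nat by rewrite -[in LHS]def_ga h'E.
    apply/andP; split; first by apply/forallP=> i; rewrite gaE leq_subr.
    rewrite -[X in (_ + X)%N]sum_h -big_split /=; apply/eqP/eq_bigr => i _.
    by rewrite gaE subnK.
  have := Bga; case/andP=> /forallP le_ga /eqP sum_ga; split; last first.
    by apply/eqP/ffunP=> i; apply: val_inj; rewrite /= h'E hE // subKn.
  apply/andP; split; last by apply/forallP=> i; rewrite hE // leq_subr.
  rewrite -(eqn_add2l (\sum_i0 ga i0)) sum_ga -big_split /=.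
  by apply/eqP/eq_bigr => j _; rewrite hE // subnKC.
case/andP=> /andP [_ /forallP le_h] /eqP def_ga; apply: F_alt.1 => i.
by rewrite -[in RHS]def_ga h'E subzn.
Qed.

(** If [i] is the first row at which the strip condition fails, exchanging the
    entries [i] and [i.+1] preserves the conditions, [i] remaining the first
    such row, while [F] changes sign. *)
Lemma sum_broken_strips i :
  \sum_(ga | box ga && (breaks_strip ga i
                 && [forall i' : 'I_l, (i' < i)%N ==> ~~ breaks_strip ga i']))
    evalF ga = 0.
Proof.
have [lt_i|ge_i] := ltnP i.+1 l; last first.
  apply: big_pred0 => ga; apply/negbTE; rewrite !negb_and; apply/orP; right.
  apply/orP; left; apply/existsPn=> j; rewrite negb_and; apply/orP; left.
  by have := ltn_ord j; lia.
pose j := Ordinal lt_i; have neq_ij : i != j by rewrite -val_eqE /=; lia.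
pose sw (ga : {ffun 'I_l -> 'I_N.+1}) : {ffun 'I_l -> 'I_N.+1} :=
  [ffun x => ga (tperm i j x)].
have swK : involutive sw by move=> ga; apply/ffunP=> x; rewrite !ffunE tpermK.
set T := (X in \sum_(ga | X ga) _).
have breaks_i ga : breaks_strip ga i = (ga i <= v j)%N.
  apply/existsP/idP => [[j' /andP [/eqP def_j]]|le_ga].
    by have -> : j' = j by apply: val_inj.
  by exists j; rewrite eqxx.
have T_sw ga : T ga -> T (sw ga).
  case/and3P=> /andP [/forallP le_ga sum_ga].
  rewrite breaks_i => le_ij /forallP first_i.
  apply/and3P; split.
  - apply/andP; split.
      apply/forallP=> x; rewrite ffunE; case: tpermP => [->|->|_ _] //.
      by apply: leq_trans (le_ga j) _; apply/ltnW/v_decr.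
    rewrite -(eqP sum_ga); apply/eqP; congr (_ + _)%N.
    rewrite [RHS](reindex_inj (@perm_inj _ (tperm i j))) /=.
    by apply: eq_bigr => x _; rewrite ffunE.
  - by rewrite breaks_i ffunE tpermL.
  apply/forallP=> i'; apply/implyP=> lt_i'.
  have := implyP (first_i i') lt_i'; rewrite /breaks_strip ffunE tpermD //.
    by rewrite -val_eqE /=; lia.
  by rewrite -val_eqE /=; lia.
have evalF_sw ga : evalF (sw ga) = - evalF ga.
  rewrite -(alternating_swap _ F_alt neq_ij).
  by apply: F_alt.1 => x; rewrite ffunE.
have: \sum_(ga | T ga) evalF ga = - \sum_(ga | T ga) evalF ga.
  rewrite {1}(reindex_inj (inv_inj swK)) -sumrN /=; apply: eq_big => // ga.
  by apply/idP/idP=> /T_sw //; rewrite swK.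
move/eqP; rewrite -subr_eq0 opprK -mulr2n mulrn_eq0 /=.
by move/eqP.
Qed.

(** The rule of Pieri: the removals that are not horizontal strips cancel out,
    according to the first row at which they fail to be one. *)
Lemma pieri :
  \sum_(al : {ffun 'I_l -> 'I_k.+1} | (\sum_i al i)%N == k)
      F (fun i => (v i)%:Z - (al i)%:Z)
    = \sum_(ga : {ffun 'I_l -> 'I_N.+1} |
              ([forall i, ga i <= v i]%N && (\sum_i ga i + k == \sum_i v i)%N)
              && [forall i, ~~ breaks_strip ga i])
        F (fun i => (ga i)%:Z).
Proof.
rewrite sum_removals (bigID (fun ga => [forall i, ~~ breaks_strip ga i])) /=.
rewrite -[RHS]addr0; congr (_ + _).
pose first ga := [pick i | breaks_strip ga i
          && [forall i' : 'I_l, (i' < i)%N ==> ~~ breaks_strip ga i']].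
rewrite (partition_big first xpredT) //= big1 // => -[i|] _; last first.
  apply: big1 => ga /andP [/andP [_ /forallPn /= [i0]]].
  rewrite negbK => bad_i0; rewrite /first; case: pickP => // none _.
  have [i bad_i min_i] := arg_minnP (fun i : 'I_l => val i) bad_i0.
  case/andP: (none i); split=> //; apply/forallP=> i'; apply/implyP=> lt_i'.
  by apply/negP=> /min_i /=; rewrite leqNgt lt_i'.
rewrite -[RHS](sum_broken_strips i); apply: eq_bigl => ga.
rewrite -andbA; congr (_ && _); apply/andP/andP.
  rewrite /first; case: pickP => [j /andP [bad_j fst_j]|_] [_ /eqP] //.
  by case=> <-.
case=> bad_i first_i; split.
  by apply/forallPn; exists i; rewrite negbK.
rewrite /first; case: pickP => [j /andP [bad_j first_j]|/(_ i)]; last first.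
  by rewrite bad_i first_i.
apply/eqP; congr Some; apply: val_inj; apply/eqP; rewrite eqn_leq.
by apply/andP; split; rewrite leqNgt; apply/negP=> lt;
  [case/negP: (implyP (forallP first_j i) lt)
  |case/negP: (implyP (forallP first_i j) lt)].
Qed.

End Pieri.

(** * Dominance *)

Definition beta l (la : seq nat) (i : 'I_l) : nat :=
  (nth 0%N la i + rev_ord i)%N.

Definition betaz l (la : seq nat) (i : 'I_l) : int := (beta la i)%:Z.

(** A partition dominates another one of the same size if and only if it does
    not have more cells in its first [k] columns, for each [k]: this form of the
    order makes sense for compositions as well. *)
Definition cells (k : nat) (la : seq nat) : nat := \sum_(x <- la) minn x k.

Definition cellsv l (v : 'I_l -> nat) (k : nat) : nat :=
  \sum_i minn (v i - rev_ord i) k.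

Definition decreasing l (v : 'I_l -> nat) :=
  forall i j : 'I_l, (i < j)%N -> (v j < v i)%N.

Lemma sum_nth_ord l la (f : nat -> nat) : f 0%N = 0%N -> (size la <= l)%N ->
  (\sum_(i < l) f (nth 0%N la i))%N = \sum_(x <- la) f x.
Proof.
move=> f0; elim: la l => [|x la IHla] [|l] //=; rewrite ?ltnS => le_l.
- by rewrite big_ord0 big_nil.
- by rewrite big_nil big1 // => i _; rewrite nth_nil.
by rewrite big_ord_recl big_cons /= IHla.
Qed.

Lemma sumn_nth_ord l la : (size la <= l)%N ->
  (\sum_(i < l) nth 0%N la i)%N = sumn la.
Proof. by move=> le_l; rewrite (@sum_nth_ord l la id) // sumnE. Qed.

Lemma nth_sorted_geq la i j : sorted geq la -> (i <= j)%N ->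
  (nth 0 la j <= nth 0 la i)%N.
Proof.
move=> sort_la le_ij; have [lt_j|ge_j] := ltnP j (size la); last first.
  by rewrite nth_default.
apply: (sorted_leq_nth (leT := geq)) => //.
- by move=> x y z /= le_xy le_zx; apply: leq_trans le_zx le_xy.
- exact: leqnn.
exact: leq_ltn_trans le_ij lt_j.
Qed.

Lemma beta_decreasing l la : sorted geq la -> decreasing (@beta l la).
Proof.
move=> sort_la i j lt_ij; rewrite /beta /=.
have := nth_sorted_geq sort_la (ltnW lt_ij); have := ltn_ord j; lia.
Qed.

Lemma cellsv_beta l la k : (size la <= l)%N -> cellsv (@beta l la) k = cells k la.
Proof.
move=> le_l; rewrite /cells -(@sum_nth_ord l la (minn^~ k)) ?min0n //.
by apply: eq_bigr => i _; rewrite /beta addnK.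
Qed.

Lemma decreasing_gap l (v : 'I_l -> nat) (i j : 'I_l) : decreasing v ->
  (i <= j)%N -> (v j + (j - i) <= v i)%N.
Proof.
move=> v_decr; have [d] := ubnP (j - i)%N; elim: d j => // d IHd j.
rewrite ltnS => le_d le_ij; have [eq_ij|ne_ij] := eqVneq i j.
  by rewrite eq_ij subnn addn0.
have lt_ij : (i < j)%N by rewrite ltn_neqAle le_ij andbT.
have lt_j : (j.-1 < l)%N by apply: leq_ltn_trans (ltn_ord j); apply: leq_pred.
have := IHd (Ordinal lt_j) _ _; have := v_decr (Ordinal lt_j) j.
by move=> /= H1 H2; have := H1 _; have := H2 _ _; lia.
Qed.

Lemma decreasing_ge l (v : 'I_l -> nat) i : decreasing v -> (rev_ord i <= v i)%N.
Proof.
move=> v_decr; case: l v i v_decr => [|l] v i v_decr; first by case: i.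
have := decreasing_gap v_decr (leq_ord i : (i <= @ord_max l)%N).
by rewrite /=; lia.
Qed.

(** The part of the strip lying in the first [c] columns has at most one cell
    in each column. *)
Lemma strip_cells l N (v : 'I_l -> nat) (ga : {ffun 'I_l -> 'I_N.+1}) k c :
    decreasing v -> (forall i, ga i <= v i)%N ->
    (\sum_i ga i + k = \sum_i v i)%N -> (forall i, ~~ breaks_strip v ga i) ->
  decreasing (fun i => ga i : nat) /\
  (cellsv v c <= minn k c + cellsv (fun i => ga i : nat) c)%N.
Proof.
move=> v_decr le_ga sum_ga strip.
have lt_ga (i j : 'I_l) : j = i.+1 :> nat -> (v j < ga i)%N.
  move=> def_j; rewrite ltnNge; apply/negP=> le_v.
  by case/existsP: (strip i); exists j; rewrite def_j eqxx.
have ga_decr : decreasing (fun i => ga i : nat).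
  move=> i j lt_ij; have lt_i : (i.+1 < l)%N by apply: leq_ltn_trans (ltn_ord j).
  have := lt_ga i (Ordinal lt_i) erefl; have := le_ga j.
  have := decreasing_gap v_decr (lt_ij : (Ordinal lt_i <= j)%N).
  by move=> /=; lia.
split=> //; rewrite addn_minl leq_min; apply/andP; split.
  rewrite /cellsv -(leq_add2l (\sum_i0 ga i0)) addnA sum_ga -!big_split /=.
  apply: leq_sum => i _; have := le_ga i; have := decreasing_ge i ga_decr.
  rewrite /=; lia.
case: l v ga v_decr le_ga sum_ga strip lt_ga ga_decr => [|l] v ga v_decr le_ga.
  by rewrite /cellsv !big_ord0.
move=> _ _ lt_ga _; rewrite /cellsv big_ord_recl leq_add ?geq_minr //.
rewrite big_ord_recr /= (leq_trans _ (leq_addr _ _)) //.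
apply: leq_sum => i _; have := lt_ga (widen_ord (leqnSn l) i) (lift ord0 i) erefl.
have := ltn_ord i; rewrite /= /bump /=; lia.
Qed.

Lemma row_avg_frob_neg n l mu (u : 'I_l -> int) i :
  u i < 0 -> row_avg mu (@frob n l u) = 0.
Proof.
move=> u_neg; rewrite -[RHS](@row_avg_const n mu); apply: eq_row_avg => g.
exact: frob_neg u_neg.
Qed.

Lemma leq_sum_ord l (v : 'I_l -> nat) i : (v i < (\sum_j v j).+1)%N.
Proof. by rewrite ltnS (bigD1 i) //= leq_addr. Qed.

Lemma row_avg_frob_strips l k mu (v : 'I_l -> nat) : decreasing v ->
  row_avg (k :: mu) (@frob (k + sumn mu) l (fun i => (v i)%:Z))
    = \sum_(ga : {ffun 'I_l -> 'I_(\sum_i v i).+1} |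
              ([forall i, ga i <= v i]%N && (\sum_i ga i + k == \sum_i v i)%N)
              && [forall i, ~~ breaks_strip v ga i])
        row_avg mu (@frob (sumn mu) l (fun i => (ga i)%:Z)).
Proof.
move=> v_decr; rewrite row_avg_frob_cons.
exact: (@pieri l k _ v _ (leq_sum_ord v) v_decr
  (row_avg_alternating _ _ _) (@row_avg_frob_neg _ _ _)).
Qed.

(** Nonvanishing yields a chain of horizontal strips with the sizes listed in
    [mu] that exhausts the diagram; each strip has at most [minn k c] cells in
    the first [c] columns, [k] being its size. *)
Lemma row_avg_frob_cells l mu (v : 'I_l -> nat) : decreasing v ->
    row_avg mu (@frob (sumn mu) l (fun i => (v i)%:Z)) != 0 ->
  forall c, (cellsv v c <= cells c mu)%N.
Proof.
elim: mu v => [|k mu IHmu] v v_decr nz c.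
  move: nz; rewrite row_avg_nil frob0 => /staircase_det_neq0 [w v_w].
  rewrite /cells big_nil /cellsv big1 // => i _.
  case: l v v_decr w v_w i => [|l] v v_decr w v_w i; first by case: i.
  have := decreasing_gap v_decr (leq0n i : (@ord0 l <= i)%N).
  by have := v_w ord0; rewrite /=; lia.
move: nz; rewrite row_avg_frob_strips // => nz.
have [ga Pga nz_ga] : exists2 ga : {ffun 'I_l -> 'I_(\sum_i v i).+1},
    ([forall i, ga i <= v i]%N && (\sum_i ga i + k == \sum_i v i)%N)
      && [forall i, ~~ breaks_strip v ga i]
    & row_avg mu (@frob (sumn mu) l (fun i => (ga i)%:Z)) != 0.
  apply/exists_inP; apply: contraR nz; rewrite negb_exists_in => /forall_inP z.
  by rewrite big1 // => ga /z; rewrite negbK => /eqP.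
case/andP: Pga => /andP [/forallP le_ga /eqP sum_ga] /forallP strip.
have [ga_decr le_c] := strip_cells c v_decr le_ga sum_ga strip.
rewrite /cells big_cons; apply: leq_trans le_c _; rewrite leq_add2l.
exact: (IHmu (fun i => ga i : nat)).
Qed.

(** A horizontal strip with as many cells as the first row meets every column:
    it consists of the lowest cells of the columns, and what remains is the
    partition without its first row.  So there is one chain of strips. *)
Lemma row_avg_frob_diag l la : sorted geq la -> (size la <= l)%N ->
  row_avg la (@frob (sumn la) l (@betaz l la)) = 1.
Proof.
elim: la => [|k la IHla] sort_la le_l.
  rewrite row_avg_nil frob0 -[RHS](staircase_det1 l).
  by apply: (staircase_det_alternating l).1 => i; rewrite /betaz /beta nth_nil.
have sort_la' : sorted geq la by apply: path_sorted sort_la.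
have b_decr := @beta_decreasing l _ sort_la.
have b_decr' := @beta_decreasing l _ sort_la'.
have le_b i : (@beta l la i <= @beta l (k :: la) i)%N.
  rewrite /beta leq_add2r.
  by apply: leq_trans (nth_sorted_geq sort_la (leqnSn i)).
have sum_b : (\sum_i @beta l la i + k = \sum_i @beta l (k :: la) i)%N.
  rewrite /beta !big_split /= !sumn_nth_ord ?(ltnW le_l) //=.
  by rewrite addnAC [(sumn la + k)%N]addnC.
rewrite (@row_avg_frob_strips l k la (@beta l (k :: la)) b_decr).
pose ga0 : {ffun 'I_l -> 'I_(\sum_i @beta l (k :: la) i).+1} :=
  [ffun i => inord (beta la i)].
have ga0E i : ga0 i = beta la i :> nat.
  by rewrite ffunE inordK // (leq_ltn_trans (le_b i)) // leq_sum_ord.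
rewrite (big_pred1 ga0) => [|ga].
  rewrite -[RHS](IHla sort_la' (ltnW le_l)).
  by apply: (row_avg_alternating _ _ _).1 => i; rewrite ga0E.
apply/idP/eqP=> [|->]; last first.
  apply/andP; split; first (apply/andP; split).
  - by apply/forallP=> i; rewrite ga0E.
  - apply/eqP; apply: etrans sum_b; congr (_ + _)%N.
    by apply: eq_bigr => i _.
  apply/forallP=> i; apply/existsP=> -[j /andP [/eqP def_j]].
  by rewrite ga0E /beta /= def_j /=; have := ltn_ord j; lia.
case/andP=> /andP [/forallP le_ga /eqP sum_ga] /forallP strip.
have ge_ga i : (beta la i <= ga i)%N.
  have [ga_decr _] := strip_cells 0 b_decr le_ga sum_ga strip.
  have [lt_i|ge_i] := ltnP i.+1 l.
    have /existsPn /(_ (Ordinal lt_i)) := strip i.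
    by rewrite /= eqxx /= -ltnNge /beta /=; lia.
  rewrite /beta nth_default; last by rewrite /= in le_l; lia.
  exact: (decreasing_ge i ga_decr).
apply/ffunP=> i; apply: val_inj; rewrite /= ga0E; apply/eqP.
have sum_rest : (\sum_(j | j != i) @beta l la j <= \sum_(j | j != i) ga j)%N.
  by apply: leq_sum => j _; apply: ge_ga.
have eq_sum : (\sum_i @beta l la i = \sum_i ga i)%N.
  by apply/eqP; rewrite -(eqn_add2r k) sum_b sum_ga.
move: eq_sum (ge_ga i) sum_rest; rewrite (bigD1 i) // [RHS](bigD1 i) //=; lia.
Qed.

(** * Irreducibility *)

Definition cellsf l (c : 'I_l -> nat) (k : nat) : nat := \sum_i minn (c i) k.

Section Staircase.

Variables (l : nat) (la : seq nat) (w : 'S_l) (c : 'I_l -> nat).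
Hypotheses (sort_la : sorted geq la) (size_la : (size la <= l)%N).
Hypothesis def_c : forall i, (c i + rev_ord (w i) = beta la i)%N.

(** Row by row comparison, once the staircase has been truncated at the
    number of rows of length at most [k]: that does not change the sum of its
    entries, as [w] permutes them. *)
Lemma staircase_shift k :
  exists m, (forall i, minn (c i) k + minn (rev_ord (w i)) m
                        <= minn (nth 0 la i) k + minn (rev_ord i) m)%N
         /\ (forall i : 'I_l, (nth 0 la i <= k)%N -> (rev_ord i <= m)%N).
Proof.
pose p := find (fun x => x <= k)%N la.
have le_p : (p <= size la)%N by apply: find_size.
have small i : (p <= i)%N -> (nth 0 la i <= k)%N.
  move=> le_pi; apply: leq_trans (nth_sorted_geq sort_la le_pi) _.
  have [lt_p|ge_p] := ltnP p (size la); last by rewrite nth_default.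
  by apply: (nth_find 0%N (a := fun x => x <= k)%N); rewrite has_find.
have big i : (i < p)%N -> (k < nth 0 la i)%N.
  by move=> lt_i; rewrite ltnNge (before_find 0%N lt_i).
exists (l - p)%N; split=> i.
  have := def_c i; rewrite /beta /=; have := ltn_ord i.
  by have [p_i|p_i] := leqP p i; [have := small i p_i | have := big i p_i]; lia.
move=> le_k; have [p_i|/big] := leqP p i; last by rewrite ltnNge le_k.
by rewrite /=; lia.
Qed.

Lemma sum_staircase_perm m :
  (\sum_i minn (rev_ord (w i)) m = \sum_(i < l) minn (rev_ord i) m)%N.
Proof. by rewrite [RHS](reindex_inj (@perm_inj _ w)). Qed.

(** Sum the comparisons of rows in [staircase_shift]: the truncated staircases
    cancel.  So all the terms of the determinant of Jacobi and Trudi belong to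
    compositions that dominate [la]. *)
Lemma cellsf_shift k : (cellsf c k <= cells k la)%N.
Proof.
have [m [le_m _]] := staircase_shift k.
rewrite /cells -(@sum_nth_ord l la (minn^~ k)) ?min0n //.
rewrite -(leq_add2r (\sum_i minn (rev_ord (w i)) m)) [in X in (_ <= X)%N]sum_staircase_perm.
by rewrite -!big_split; apply: leq_sum => i _; apply: le_m.
Qed.

Lemma sum_shift : (\sum_i c i)%N = sumn la.
Proof.
rewrite -(sumn_nth_ord size_la).
apply/eqP; rewrite -(eqn_add2r (\sum_i rev_ord (w i))) -big_split /=.
rewrite (eq_bigr _ (fun i _ => def_c i)) /beta big_split eqn_add2l.
by rewrite [X in X == _](reindex_inj (@perm_inj _ w)).
Qed.

(** When the numbers of cells agree, all the inequalities between rows in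
    [staircase_shift] are equalities; for [k] the length of row [i], the one at
    [i] bounds [c i] by that length. *)
Lemma cellsf_shift_eq :
  (forall i : 'I_l, (cells (nth 0 la i) la <= cellsf c (nth 0 la i))%N) ->
  forall i, c i = nth 0%N la i.
Proof.
move=> ge_c.
have le_c i : (c i <= nth 0 la i)%N.
  set k := nth 0%N la i.
  have [m [le_m /(_ i (leqnn _)) le_im]] := staircase_shift k.
  have := ge_c i; rewrite /cellsf /cells -(@sum_nth_ord l la (minn^~ k)) ?min0n //.
  rewrite -(leq_add2r (\sum_i minn (rev_ord (w i)) m)).
  rewrite [in X in (X <= _)%N]sum_staircase_perm -!big_split /=.
  rewrite (bigD1 i) // [X in (_ <= X)%N](bigD1 i) //=.
  have : (\sum_(j | j != i) (minn (c j) k + minn (rev_ord (w j)) m) <=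
          \sum_(j < l | j != i) (minn (nth 0 la j) k + minn (rev_ord j) m))%N.
    by apply: leq_sum => j _; apply: le_m.
  move: le_im (def_c i); rewrite /beta /= -/k.
  by move: (\sum_(j | _) _)%N (\sum_(j | _) _)%N => S1 S2; lia.
move=> i; have := sum_shift; rewrite -(sumn_nth_ord size_la).
rewrite (bigD1 i) // [X in _ = X](bigD1 i) //=.
have : (\sum_(j | j != i) c j <= \sum_(j < l | j != i) nth 0 la j)%N.
  by apply: leq_sum => j _; apply: le_c.
by move: (le_c i) (\sum_(j | _) _)%N (\sum_(j | _) _)%N => le_i S1 S2; lia.
Qed.

End Staircase.

Lemma row_avg_cells n l la mu : sumn mu = n -> sorted geq la ->
    (size la <= l)%N -> row_avg mu (@frob n l (betaz la)) != 0 ->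
  forall k, (cells k la <= cells k mu)%N.
Proof.
move=> <- sort_la le_l nz k; rewrite -(cellsv_beta _ le_l).
exact: row_avg_frob_cells (beta_decreasing sort_la) nz k.
Qed.

Lemma row_avg_frob_diagE n l la : sumn la = n -> sorted geq la ->
  (size la <= l)%N -> row_avg la (@frob n l (betaz la)) = 1.
Proof. by move=> <-; apply: row_avg_frob_diag. Qed.

Lemma staircase_det_int l (u : 'I_l -> int) : staircase_det u \in Num.int.
Proof.
apply: rpred_sum => s _; apply: rpredM; first by rewrite rpred_sign.
by apply: rpred_prod => i _; rewrite mxE rpred_nat.
Qed.

Section Irreducible.

Variable n : nat.
Notation Sn := [set: 'S_n].

Lemma cards_Sn : #|Sn|%:R = n`!%:R :> algC.
Proof. by rewrite cardsT card_Sn. Qed.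

Lemma cfdot_Sn (phi psi : 'CF(Sn)) :
  '[phi, psi] = n`!%:R^-1 * \sum_(g : 'S_n) phi g * (psi g)^*.
Proof.
rewrite cfdotE cards_Sn; congr (_ * _).
by apply: eq_bigl => g; rewrite inE.
Qed.

Lemma row_avg_cfdot mu (phi : 'CF(Sn)) :
  row_avg mu phi = '[phi, 'Ind[Sn, row_stab n mu] 1].
Proof.
rewrite -cfdot_Res_l cfdotE; congr (_ * _); apply: eq_bigr => g Rg.
by rewrite cfun1E Rg rmorph1 mulr1 cfResE ?subsetT.
Qed.

Lemma cfunJ_Sn (phi : 'CF(Sn)) (g h : 'S_n) : phi (g ^ h)%g = phi g.
Proof. by rewrite cfunJ ?inE. Qed.

Fact frob_class_fun l (v : 'I_l -> int) :
  is_class_fun <<Sn>> [ffun g : 'S_n => frob v g].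
Proof.
apply: intro_class_fun => [g h _ _|g]; first exact: frobJ.
by case/negP; rewrite mem_gen ?inE.
Qed.

Definition frob_cfun l (v : 'I_l -> int) : 'CF(Sn) := Cfun 0 (frob_class_fun v).

Lemma frob_cfunE l (v : 'I_l -> int) g : frob_cfun v g = frob v g.
Proof. by rewrite cfunE. Qed.

Lemma cfdot_frob l (v : 'I_l -> int) (phi : 'CF(Sn)) :
  '[phi, frob_cfun v] =
    \sum_(al : {ffun 'I_l -> 'I_n.+1} | (\sum_i al i)%N == n)
      staircase_det (fun i => v i - (al i)%:Z) * row_avg (content_ffun al) phi.
Proof.
pose G c := staircase_det (fun i : 'I_l => v i - (c i)%:Z).
have Gext c c' : c =1 c' -> G c = G c'.
  by move=> eq_c; apply: (staircase_det_alternating l).1 => i; rewrite eq_c.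
rewrite cfdot_Sn -(@sum_words n l G phi (cfunJ_Sn phi) Gext).
by congr (_ * _); apply: eq_bigr => g _; rewrite frob_cfunE frob_real.
Qed.

Lemma row_avg_char_nat mu i : row_avg mu ('chi[Sn]_i) \in Num.nat.
Proof.
rewrite row_avg_cfdot; apply: Cnat_cfdot_char; first exact: irr_char.
exact/cfInd_char/rpred1.
Qed.

Lemma frob_vchar l (v : 'I_l -> int) : frob_cfun v \in 'Z[irr Sn].
Proof.
rewrite [frob_cfun v]cfun_sum_cfdot; apply: rpred_sum => i _.
apply: scale_zchar; last exact: irr_vchar.
rewrite cfdotC cfdot_frob rmorph_sum /=; apply: rpred_sum => al _.
have /intrP[z ->] : staircase_det (fun i => v i - (al i)%:Z) *
    row_avg (content_ffun al) 'chi[Sn]_i \in Num.int.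
  by apply: rpredM; [apply: staircase_det_int
                    | apply: intr_nat; apply: row_avg_char_nat].
by rewrite rmorph_int rpred_int.
Qed.

Lemma content_ffunE l (al : {ffun 'I_l -> 'I_n.+1}) (i : 'I_l) :
  nth 0%N (content_ffun al) i = al i.
Proof. by rewrite (nth_map i) ?size_enum_ord // nth_ord_enum. Qed.

Lemma size_content_ffun l (al : {ffun 'I_l -> 'I_n.+1}) :
  size (content_ffun al) = l.
Proof. by rewrite size_map size_enum_ord. Qed.

Lemma sumn_content_ffun l (al : {ffun 'I_l -> 'I_n.+1}) :
  sumn (content_ffun al) = (\sum_i al i)%N.
Proof. by rewrite sumnE big_map big_enum. Qed.

Lemma staircase_det_shift l la (al : 'I_l -> nat) :
    staircase_det (fun i => betaz la i - (al i)%:Z) != 0 ->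
  exists w : 'S_l, forall i, (al i + rev_ord (w i) = beta la i)%N.
Proof.
case/staircase_det_neq0=> w def_w; exists w => i.
by have := def_w i; rewrite /betaz; lia.
Qed.

Variables (la : seq nat).
Hypotheses (sort_la : sorted geq la) (sum_la : sumn la = n).
Let l := size la.
Let F := frob_cfun (@betaz l la).

Lemma row_avg_frob_self : row_avg la F = 1.
Proof.
rewrite (eq_row_avg _ (frob_cfunE _)).
exact: row_avg_frob_diagE (leqnn _).
Qed.

(** Expand one factor over compositions.  A term that does not vanish belongs to
    a composition that dominates [la], by [cellsf_shift], and is dominated by
    [la], by [row_avg_cells]: only [la] itself remains. *)
Lemma frob_norm : '[F] = 1.
Proof.
have lt_la (i : 'I_l) : (nth 0 la i < n.+1)%N.
  rewrite ltnS -sum_la -(sumn_nth_ord (leqnn (size la))).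
  by rewrite (bigD1 i) //= leq_addr.
pose al0 : {ffun 'I_l -> 'I_n.+1} := [ffun i => Ordinal (lt_la i)].
have al0E : content_ffun al0 = la.
  apply: (@eq_from_nth _ 0%N); rewrite size_content_ffun // => i lt_i.
  by rewrite (content_ffunE _ (Ordinal lt_i)) ffunE.
rewrite cfdot_frob (bigD1 al0) /=; last by rewrite -sumn_content_ffun al0E sum_la.
rewrite al0E row_avg_frob_self mulr1 big1 ?addr0 => [|al].
  rewrite -[RHS](staircase_det1 l).
  apply: (staircase_det_alternating l).1 => i.
  by rewrite ffunE /betaz /beta PoszD addrAC subrr add0r.
case/andP=> /eqP sum_al ne_al; apply/eqP; apply: contraR ne_al.
rewrite mulf_eq0 negb_or => /andP [/staircase_det_shift [w def_w] nz].
apply/eqP/ffunP=> i; apply: val_inj; rewrite ffunE /=.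
apply: (cellsf_shift_eq sort_la (leqnn _) def_w) => j.
have nz' : row_avg (content_ffun al) (@frob n l (betaz la)) != 0.
  by rewrite -(eq_row_avg _ (frob_cfunE _)).
apply: leq_trans (row_avg_cells _ sort_la (leqnn _) nz' _) _.
  by rewrite sumn_content_ffun.
by rewrite /cells big_map big_enum.
Qed.

(** A generalised character of norm 1 is irreducible up to sign, and the
    multiplicity 1 in a permutation character determines the sign. *)
Lemma frob_irr : exists i, F = 'chi_i.
Proof.
have [b [i defF]] := vchar_norm1P (frob_vchar _) frob_norm.
exists i; move: defF; rewrite -/F; case: b => [|->]; last by rewrite scale1r.
rewrite expr1 scaleN1r => defF.
have := row_avg_frob_self; rewrite defF => row1.
have: row_avg la (- 'chi_i) <= 0.
  rewrite row_avg_cfdot cfdotNl oppr_le0 -row_avg_cfdot natr_ge0 //.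
  exact: row_avg_char_nat.
by rewrite row1 ler10.
Qed.

End Irreducible.

(** * The constituents that define the characters of the symmetric group *)

Section Diagram.

Variables (n : nat) (la : seq nat).
Hypothesis sum_la : sumn la = n.

Lemma diagram_inj (x y : 'I_n) :
  reshape_index la x = reshape_index la y ->
  reshape_offset la x = reshape_offset la y -> x = y.
Proof.
move=> eq_r eq_c; apply: val_inj.
by rewrite /= -(reshape_indexK la x) eq_r eq_c reshape_indexK.
Qed.

Lemma row_col_stab (g : 'S_n) :
  g \in row_stab n la -> g \in col_stab n la -> g = 1%g.
Proof.
rewrite !inE => /forallP Rg /forallP Cg; apply/permP=> x; rewrite perm1.
by apply: diagram_inj; apply/eqP; [apply: Rg | apply: Cg].
Qed.

End Diagram.

Lemma count_cols la k :
  (\sum_(x < sumn la) (reshape_offset la x < k))%N = cells k la.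
Proof.
rewrite /cells; elim: la => [|m la IHla] /=; first by rewrite big_ord0 big_nil.
rewrite big_split_ord big_cons -IHla /=; congr (_ + _)%N.
  under eq_bigr do rewrite reshape_offset_cons ltn_ord.
  rewrite -(big_mkord xpredT (fun i => (i < k)%N : nat)).
  elim: m => [|m IHm]; first by rewrite big_nil min0n.
  by rewrite big_nat_recr //= IHm; case: (ltnP m k); lia.
by apply: eq_bigr => x _; rewrite reshape_offset_cons /= [(_ + _ < m)%N]ltnNge leq_addr /= addKn.
Qed.

(** Multiplication by [h] reverses the signs. *)
Lemma sum_sign_odd n (P : pred 'S_n) (h : 'S_n) : odd_perm h ->
  (forall g, P (h * g)%g = P g) -> \sum_(g | P g) (-1) ^+ odd_perm g = 0 :> algC.
Proof.
move=> odd_h Ph; apply/eqP; rewrite -[_ == 0](mulrn_eq0 _ 2) mulr2n.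
rewrite [X in X + _](reindex_inj (mulgI h)) /= addrC -subr_eq0 subr0.
rewrite (eq_bigl _ _ Ph) -big_split /= big1 // => g _.
by rewrite odd_permM odd_h /= signrN addrN.
Qed.

Lemma sum_sign_group n (K : {group 'S_n}) :
  0 <= \sum_(g in K) (-1) ^+ odd_perm g :> algC.
Proof.
have [h /andP [Kh odd_h]|no_odd] := pickP [pred h in K | odd_perm h].
  by rewrite (sum_sign_odd odd_h) // => g; rewrite groupMl.
apply: sumr_ge0 => g Kg; have := no_odd g; rewrite /= Kg /= => ->.
by rewrite ler01.
Qed.

Section SpechtConstituents.

Variables (n : nat) (nu : seq nat).
Hypothesis sum_nu : sumn nu = n.
Notation Sn := [set: 'S_n].
Notation R := (row_stab n nu).
Notation C := (col_stab n nu).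

Lemma sign_charE (g : 'S_n) : sign_char n g = (-1) ^+ odd_perm g.
Proof. by rewrite cfunE. Qed.

Lemma cfdot_col_sign (phi : 'CF(Sn)) :
  '[phi, 'Ind[Sn, C] ('Res[C] (sign_char n))]
    = #|C|%:R^-1 * \sum_(g in C) phi g * (-1) ^+ odd_perm g.
Proof.
rewrite -cfdot_Res_l cfdotE; congr (_ * _); apply: eq_bigr => g Cg.
by rewrite !cfResE ?subsetT // sign_charE rmorph_sign.
Qed.

(** The formula for induced characters gives, for each [y], a sum of signs over
    the subgroup [C :&: R :^ y^-1]: it is nonnegative, and for [y] trivial it is 1
    because the two stabilisers meet trivially. *)
Lemma cfdot_row_col :
  '['Ind[Sn, R] 1, 'Ind[Sn, C] ('Res[C] (sign_char n))] != 0.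
Proof.
rewrite cfdot_col_sign mulf_neq0 ?invr_eq0 ?pnatr_eq0 -?lt0n ?cardG_gt0 //.
under eq_bigr => g _ do rewrite (cfIndE _ _ (subsetT R)) -mulrA mulr_suml.
rewrite -mulr_sumr mulf_neq0 ?invr_eq0 ?pnatr_eq0 -?lt0n ?cardG_gt0 //.
rewrite exchange_big.
have inner y : \sum_(g in C) (1 : 'CF(R)) (g ^ y)%g * (-1) ^+ odd_perm g
    = \sum_(g in C :&: R :^ y^-1) (-1) ^+ odd_perm g.
  rewrite [RHS](eq_bigl (fun g => (g \in C) && (g ^ y \in R)%g)); last first.
    by move=> g; rewrite inE mem_conjgV.
  rewrite [RHS]big_mkcondr; apply: eq_bigr => g _; rewrite cfun1E.
  by case: (g ^ y \in R)%g; rewrite ?mul1r ?mul0r.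
rewrite (eq_bigr _ (fun y _ => inner y)) (bigD1 1%g) ?inE //=.
rewrite gt_eqF // ltr_wpDr //.
  by apply: sumr_ge0 => y _; apply: (sum_sign_group [group of C :&: R :^ y^-1]).
rewrite invg1 conjsg1 (_ : C :&: R = [set 1%g]).
  by rewrite big_set1 odd_perm1 ltr01.
apply/setP=> g; rewrite inE in_set1; apply/andP/eqP=> [[Cg Rg]|->].
  exact: (row_col_stab Rg Cg).
by rewrite !group1.
Qed.

Lemma specht_constt : exists i, [/\ specht_char n nu = 'chi_i,
  i \in irr_constt ('Ind[Sn, R] 1)
  & i \in irr_constt ('Ind[Sn, C] ('Res[C] (sign_char n)))].
Proof.
rewrite /specht_char; case: pickP => [i /andP [Ri Ci]|none]; first by exists i.
case/eqP: cfdot_row_col; rewrite cfdot_sum_irr big1 // => i _.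
apply/eqP; rewrite mulf_eq0; have := none i; rewrite !irr_consttE.
by case: eqP => //= _ /negbFE /eqP ->; rewrite rmorph0 eqxx.
Qed.

(** If two integers have the same letter and the same column, their transposition
    makes the sum of signs vanish.  So equal letters are in distinct columns, and
    a letter occurs at most [k] times in the first [k] columns. *)
Lemma sum_sign_separated l (d : {ffun 'I_n -> 'I_l}) :
    \sum_(g in C | fixes g d) (-1) ^+ odd_perm g != 0 :> algC ->
  forall k, (cells k nu <= cellsf (content d) k)%N.
Proof.
move=> nz k.
have sep x y : d x = d y -> reshape_offset nu x = reshape_offset nu y -> x = y.
  move=> eq_d eq_c; apply/eqP; apply: contraR nz => ne_xy; apply/eqP.
  apply: (sum_sign_odd (h := tperm x y)); first by rewrite odd_tperm.
  move=> g; congr (_ && _).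
    rewrite groupMl // inE; apply/forallP=> z.
    by case: tpermP => [->|->|//]; rewrite eq_c.
  apply/forallP/forallP=> gd z.
    have:= gd (tperm x y z); rewrite permM tpermK => /eqP ->.
    by case: tpermP => [->|->|//]; rewrite eq_d.
  rewrite permM (eqP (gd _)).
  by case: tpermP => [->|->|//]; rewrite eq_d.
rewrite -count_cols sum_nu.
have -> : (\sum_(x < n) (reshape_offset nu x < k)
   = \sum_(i < l) \sum_(x < n) ((d x == i) && (reshape_offset nu x < k)))%N.
  rewrite exchange_big /=; apply: eq_bigr => x _; rewrite (bigD1 (d x)) //= eqxx.
  by rewrite big1 ?addn0 // => i /negbTE; rewrite eq_sym => ->.
apply: leq_sum => i _; rewrite leq_min; apply/andP; split.
  by apply: leq_sum => x _; case: (d x == i) => //=; case: (_ < _)%N.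
pose A := [pred x : 'I_n | (d x == i) && (reshape_offset nu x < k)%N].
have -> : (\sum_(x < n) ((d x == i) && (reshape_offset nu x < k)) = #|A|)%N.
  by rewrite -sum1_card [RHS]big_mkcond; apply: eq_bigr => x _; rewrite inE; case: andP.
rewrite cardE -(size_map (fun x : 'I_n => reshape_offset nu x)) -(size_iota 0 k).
apply: uniq_leq_size => [|c /mapP [x]]; last first.
  by rewrite mem_enum mem_iota => /andP [_ lt_k] ->.
rewrite map_inj_in_uniq ?enum_uniq // => x y.
rewrite !mem_enum => /andP [/eqP dx _] /andP [/eqP dy _].
by apply: sep; rewrite dx dy.
Qed.

Lemma frob_col_cells l la : sorted geq la -> (size la <= l)%N ->
    '[frob_cfun n (@betaz l la), 'Ind[Sn, C] ('Res[C] (sign_char n))] != 0 ->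
  forall k, (cells k nu <= cells k la)%N.
Proof.
move=> sort_la size_la; rewrite cfdot_col_sign => nz k.
have [d nz_d nz_sum] : exists2 d : {ffun 'I_n -> 'I_l},
    staircase_det (fun i => betaz la i - (content d i)%:Z) != 0
    & \sum_(g in C | fixes g d) (-1) ^+ odd_perm g != 0 :> algC.
  apply/exists_inP; apply: contraR nz; rewrite negb_exists_in => /forall_inP z.
  rewrite mulf_eq0; apply/orP; right; apply/eqP.
  under eq_bigr do rewrite frob_cfunE mulr_suml.
  rewrite (exchange_big_dep xpredT) //= big1 // => d _.
  rewrite -mulr_sumr; apply/eqP; rewrite mulf_eq0 orbC.
  by have [//|/z] := eqVneq (staircase_det _) 0; rewrite ?orbT // negbK => ->.
have [w def_w] := staircase_det_shift nz_d.
apply: leq_trans (sum_sign_separated nz_sum k) _.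
exact: cellsf_shift sort_la size_la def_w k.
Qed.

End SpechtConstituents.

Lemma cellsS la k :
  cells k.+1 la = (cells k la + count (fun x => k < x) la)%N.
Proof.
rewrite /cells -sum1_count [X in (_ + X)%N]big_mkcond -big_split /=.
by apply: eq_bigr => x _; case: (ltnP k x); lia.
Qed.

(** The number of parts larger than [k] is the difference of two consecutive
    numbers of cells. *)
Lemma cells_inj la nu : sorted geq la -> sorted geq nu ->
    all (leq 1) la -> all (leq 1) nu ->
  (forall k, cells k la = cells k nu) -> la = nu.
Proof.
move=> sort_la sort_nu pos_la pos_nu eq_c.
have cnt k : count (fun x => k < x)%N la = count (fun x => k < x)%N nu.
  by apply/eqP; rewrite -(eqn_add2l (cells k la)) {2}eq_c -!cellsS eq_c.
have cnt1 s k : count_mem k.+1 s =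
    (count (fun x => k < x) s - count (fun x => k.+1 < x) s)%N.
  elim: s => //= x s ->.
  have : (count (fun x => k.+1 < x) s <= count (fun x => k < x) s)%N.
    by apply: sub_count => y /= /ltnW.
  by case: (ltngtP x k.+1); lia.
apply: (sorted_eq (leT := geq)) => //.
- by move=> x y z /= le_xy le_zx; apply: leq_trans le_zx le_xy.
- by move=> x y /=; rewrite andbC -eqn_leq => /eqP.
apply/allP=> -[|k] _; last by rewrite /= !cnt1 !cnt.
have c0 s : all (leq 1) s -> count_mem 0%N s = 0%N.
  by move=> pos; apply/count_memPn/negP=> /(allP pos).
by rewrite /= !c0.
Qed.

(** * Completeness and identification *)

Lemma row_avg_perm n (phi : 'S_n -> algC) al be :
    (forall g h, phi (g ^ h)%g = phi g) -> sumn al = n -> perm_eq al be ->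
  row_avg al phi = row_avg be phi.
Proof.
move=> phiJ sum_al eq_ab.
have /tuple_permP [s def_al] : perm_eq al (in_tuple be) by [].
have size_al : size al = size be by apply: perm_size.
have sum_be : sumn be = n by rewrite -sum_al; apply/esym/perm_sumn.
have nth_al (i : 'I_(size be)) : nth 0%N al i = nth 0%N be (s i).
  by rewrite def_al -tnth_nth tnth_mktuple (tnth_nth 0%N).
have n_neq0 : n`!%:R != 0 :> algC by rewrite pnatr_eq0 -lt0n fact_gt0.
apply: (mulfI n_neq0).
rewrite -(@sum_words_content (size be) n al) // -(@sum_words_content (size be)) //.
rewrite [RHS](reindex _ (onW_bij _ (perm_ffun_bij n s))) /=.
apply: eq_big => [d|d _].
  apply/forallP/forallP=> cont_d i.
    by rewrite -(permKV s i) content_perm -nth_al; apply: cont_d.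
  by rewrite nth_al -(content_perm s); apply: cont_d.
apply: eq_bigl => g; apply: eq_forallb => x.
by rewrite !ffunE (inj_eq perm_inj).
Qed.

(** A sum over [k] of the numbers of cells in the first [k] columns: it turns
    the dominance order into a well-founded one. *)
Definition cells_sum n la : nat := \sum_(k < n.+1) cells k la.

Section Completeness.

Variable n : nat.
Notation Sn := [set: 'S_n].

(** Decreasing induction on dominance, for [la0] in decreasing order.  If the
    scalar product with the function attached to [la0] vanishes, then another
    term of its expansion over compositions does not, and that term belongs to a
    composition which strictly dominates [la0]. *)
Lemma row_avg_frob_neq0 (phi : 'CF(Sn)) la0 :
    sumn la0 = n -> row_avg la0 phi != 0 ->
  exists la, [/\ sorted geq la, sumn la = n, size la = size la0
                & '[phi, frob_cfun n (@betaz (size la) la)] != 0].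
Proof.
have [N] := ubnP (cells_sum n la0).
elim: N la0 => // N IHN la0; rewrite ltnS => le_N sum_la0.
pose la := sort geq la0.
have perm_la : perm_eq la0 la by rewrite perm_sym perm_sort.
rewrite (row_avg_perm (cfunJ_Sn phi) sum_la0 perm_la).
have sum_la : sumn la = n by rewrite -sum_la0; apply/esym/perm_sumn.
have <- : size la = size la0 by apply/esym/perm_size.
have sort_la : sorted geq la by apply: sort_sorted => x y; apply: leq_total.
have cells_la k : cells k la = cells k la0.
  by apply: perm_big; rewrite perm_sort.
have {}le_N : (cells_sum n la <= N)%N.
  by apply: leq_trans le_N; apply: leq_sum => k _; rewrite cells_la.
move: la sort_la sum_la le_N {perm_la cells_la} => la sort_la sum_la le_N nz.
have [dot0|] := eqVneq '[phi, frob_cfun n (@betaz (size la) la)] 0; last first.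
  by exists la.
have lt_la (i : 'I_(size la)) : (nth 0 la i < n.+1)%N.
  rewrite ltnS -sum_la -(sumn_nth_ord (leqnn (size la))).
  by rewrite (bigD1 i) //= leq_addr.
pose al0 : {ffun 'I_(size la) -> 'I_n.+1} := [ffun i => Ordinal (lt_la i)].
have al0E : content_ffun al0 = la.
  apply: (@eq_from_nth _ 0%N); rewrite size_content_ffun // => i lt_i.
  by rewrite (content_ffunE _ (Ordinal lt_i)) ffunE.
have det1 : staircase_det (fun i => betaz la i - (al0 i)%:Z) = 1.
  rewrite -[RHS](staircase_det1 (size la)).
  apply: (staircase_det_alternating _).1 => i.
  by rewrite ffunE /betaz /beta PoszD addrAC subrr add0r.
have [al /andP [/eqP sum_al ne_al]] : exists2 al : {ffun 'I_(size la) -> 'I_n.+1},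
    ((\sum_i al i)%N == n) && (al != al0)
    & staircase_det (fun i => betaz la i - (al i)%:Z)
        * row_avg (content_ffun al) phi != 0.
  apply/exists_inP; apply: contraR nz; rewrite negb_exists_in => /forall_inP z.
  move/eqP: dot0; rewrite cfdot_frob (bigD1 al0) /=; last first.
    by rewrite -sumn_content_ffun al0E sum_la.
  rewrite al0E det1 mul1r big1 ?addr0 // => al /z; rewrite negbK.
  by move/eqP.
rewrite mulf_eq0 negb_or => /andP [/staircase_det_shift [w def_w] nz_al].
rewrite -[size la](size_content_ffun al).
apply: IHN nz_al; last by rewrite sumn_content_ffun.
apply: leq_trans le_N.
have cells_al k : cells k (content_ffun al) = cellsf (fun i => al i : nat) k.
  by rewrite /cells big_map big_enum.
have le_cells k := cellsf_shift sort_la (leqnn _) def_w k.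
rewrite ltnNge; apply: contra ne_al => ge_sum.
apply/eqP/ffunP=> i; apply: val_inj; rewrite ffunE /=.
apply: (cellsf_shift_eq sort_la (leqnn _) def_w) => j.
rewrite -cells_al leqNgt; apply/negP=> lt_j.
move: ge_sum; rewrite /cells_sum leqNgt => /negP; case.
pose k0 := Ordinal (lt_la j).
rewrite (bigD1 k0) // [X in (_ < X)%N](bigD1 k0) //=.
rewrite -addSn leq_add //; apply: leq_sum => k _.
by rewrite cells_al.
Qed.

Lemma row_stab_column : row_stab n (nseq n 1%N) = 1%g :> {set 'S_n}.
Proof.
have sum1 : sumn (nseq n 1%N) = n by rewrite sumn_nseq mul1n.
apply/setP=> g; rewrite in_set1; apply/idP/eqP=> [Rg|->]; last exact: group1.
apply: (row_col_stab Rg); rewrite inE; apply/forallP=> x.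
have off0 (y : 'I_n) : reshape_offset (nseq n 1%N) y = 0%N.
  have lt_y : (y < sumn (nseq n 1%N))%N by rewrite sum1.
  have := reshape_offsetP lt_y; rewrite nth_nseq; case: ifP => // _.
  by case: (reshape_offset _ _).
by rewrite !off0.
Qed.

(** The row stabiliser of a column is trivial, so that averaging over it gives
    the degree, which does not vanish. *)
Lemma irr_frob (i : Iirr Sn) : exists la,
  [/\ sorted geq la, sumn la = n, size la = n
    & 'chi_i = frob_cfun n (@betaz (size la) la)].
Proof.
have [||la [sort_la sum_la size_la nz]] :=
    @row_avg_frob_neq0 'chi_i (nseq n 1%N).
- by rewrite sumn_nseq mul1n.
- by rewrite /row_avg row_stab_column cards1 invr1 mul1r big_set1 irr1_neq0.
exists la; split=> //; first by rewrite size_la size_nseq.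
have [j def_j] := frob_irr sort_la sum_la.
by move: nz; rewrite def_j cfdot_irr; have [->|_] := eqVneq i j; rewrite ?eqxx.
Qed.

End Completeness.

(** Sequences with a fixed number of rows, some of them empty, suit the
    determinants; partitions have no empty row. *)
Definition nonzero_rows (la : seq nat) : seq nat := [seq x <- la | (0 < x)%N].

Lemma cells_nonzero_rows k la : cells k (nonzero_rows la) = cells k la.
Proof.
rewrite /cells big_filter big_mkcond; apply: eq_bigr => x _.
by case: (posnP x) => [->|]; rewrite ?min0n.
Qed.

Lemma is_partitionP n la :
  is_partition n la -> [/\ sorted geq la, all (leq 1) la & sumn la = n].
Proof.
case/and3P=> sort_la no0 /eqP sum_la; split=> //; apply/allP=> x la_x.
by rewrite lt0n; apply: contraNneq no0 => <-.
Qed.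

Lemma sumn_nonzero_rows la : sumn (nonzero_rows la) = sumn la.
Proof.
by rewrite /nonzero_rows; elim: la => //= x la <-; case: posnP => [->|].
Qed.

Lemma sorted_nonzero_rows la : sorted geq la -> sorted geq (nonzero_rows la).
Proof.
apply: sorted_filter => x y z /= le_xy le_zx.
exact: leq_trans le_zx le_xy.
Qed.

Lemma nonzero_rows_partition n la :
  sorted geq la -> sumn la = n -> is_partition n (nonzero_rows la).
Proof.
move=> sort_la sum_la; apply/and3P; split.
- exact: sorted_nonzero_rows.
- by rewrite mem_filter.
by rewrite sumn_nonzero_rows sum_la.
Qed.

Section Identification.

Variable n : nat.
Notation Sn := [set: 'S_n].

(** A common constituent of the two induced characters attached to [nu]
    occurs in each of them, which gives one of the two comparisons of the shapes
    in the dominance order. *)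
Lemma specht_frob_shape nu la :
    is_partition n nu -> sorted geq la -> sumn la = n ->
    specht_char n nu = frob_cfun n (@betaz (size la) la) ->
  nonzero_rows la = nu.
Proof.
case/is_partitionP=> sort_nu pos_nu sum_nu sort_la sum_la.
have [i [-> Ri Ci]] := specht_constt n nu => def_i.
apply: cells_inj => //.
- exact: sorted_nonzero_rows.
- by apply/allP=> x; rewrite mem_filter => /andP [].
move=> k; rewrite cells_nonzero_rows; apply/eqP; rewrite eqn_leq.
apply/andP; split.
  apply: (@row_avg_cells n (size la)) => //.
  rewrite -(eq_row_avg _ (frob_cfunE _)) -def_i row_avg_cfdot.
  by move: Ri; rewrite irr_consttE cfdotC fmorph_eq0.
apply: (frob_col_cells sum_nu sort_la (leqnn _)).
by rewrite -def_i cfdotC fmorph_eq0 -irr_consttE.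
Qed.

Lemma nonzero_rows_inj la la' : sorted geq la -> sorted geq la' ->
  size la = size la' -> nonzero_rows la = nonzero_rows la' -> la = la'.
Proof.
have defz s : sorted geq s ->
    s = nonzero_rows s ++ nseq (size s - size (nonzero_rows s)) 0%N.
  elim: s => //= x s IHs sort_s; case: posnP => [x0|_] /=; last first.
    by rewrite subSS -IHs // (path_sorted sort_s).
  have s0 : all (pred1 0%N) s.
    apply/allP=> y s_y; have := order_path_min _ sort_s.
    move=> /(_ _)/allP/(_ y s_y); rewrite x0 /= leqn0; apply.
    by move=> a b c /= le_ab le_ca; apply: leq_trans le_ca le_ab.
  have -> : nonzero_rows s = [::].
    by rewrite /nonzero_rows (eq_in_filter (a2 := pred0)) ?filter_pred0 // => y
      /(allP s0) /eqP ->.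
  by rewrite subn0 x0 /=; congr (_ :: _); apply/all_pred1P.
move=> /defz defs /defz defs' eq_size eq_nz.
by rewrite defs defs' eq_nz eq_size.
Qed.

Lemma irr_specht (i : Iirr Sn) :
  exists2 nu, is_partition n nu & 'chi_i = specht_char n nu.
Proof.
have [la [sort_la sum_la size_la def_i]] := irr_frob i.
have part_la := nonzero_rows_partition sort_la sum_la.
have [_ _ sum_nu] := is_partitionP part_la.
exists (nonzero_rows la) => //.
have [j [def_j _ _]] := specht_constt n (nonzero_rows la).
have [la' [sort_la' sum_la' size_la' def_j']] := irr_frob j.
have eq_la : nonzero_rows la' = nonzero_rows la.
  by apply: specht_frob_shape => //; rewrite def_j.
suff eq_la' : la = la' by rewrite def_i eq_la' -def_j' -eq_la'.
by apply: nonzero_rows_inj => //; rewrite size_la.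
Qed.

Lemma frob_specht la : sorted geq la -> sumn la = n ->
  frob_cfun n (@betaz (size la) la) = specht_char n (nonzero_rows la).
Proof.
move=> sort_la sum_la; have [i def_i] := frob_irr sort_la sum_la.
have [nu part_nu def_nu] := irr_specht i; rewrite def_i def_nu.
by rewrite (@specht_frob_shape nu la) // def_i.
Qed.

Lemma specht_frob la : is_partition n la ->
  specht_char n la = frob_cfun n (@betaz (size la) la).
Proof.
case/is_partitionP=> sort_la pos_la sum_la; rewrite frob_specht //.
by congr specht_char; apply/esym/all_filterP.
Qed.

Lemma specht_inj la nu : is_partition n la -> is_partition n nu ->
  specht_char n la = specht_char n nu -> la = nu.
Proof.
move=> part_la part_nu; rewrite (specht_frob part_la) => /esym eq_f.
have [sort_la pos_la sum_la] := is_partitionP part_la.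
rewrite -(specht_frob_shape part_nu sort_la sum_la eq_f).
exact/esym/all_filterP.
Qed.

End Identification.

(** * Symmetric and alternating squares are characters *)

Section IdempotentCharacter.

Variables (gT : finGroupType) (G : {group gT}) (m : nat).
Variables (rG : mx_representation algC G m) (e : 'M[algC]_m).
Hypotheses (e_idem : e *m e = e).
Hypothesis e_comm : forall g, g \in G -> e *m rG g = rG g *m e.

Let C := col_base e.
Let R := row_base e.

Lemma row_col_base_idem : R *m C = 1%:M.
Proof.
apply: (row_full_inj (col_base_full e)); apply: (row_free_inj (row_base_free e)).
have CR : C *m R = e by apply: mulmx_base.
rewrite -/C -/R mulmx1 CR.
transitivity (C *m R *m (C *m R)); first by rewrite !mulmxA.
by rewrite CR e_idem.
Qed.

Fact idem_repr : mx_repr G (fun g => R *m rG g *m C).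
Proof.
split=> [|g h Gg Gh]; first by rewrite repr_mx1 mulmx1 row_col_base_idem.
have CR : C *m R = e by apply: mulmx_base.
have eC : e *m C = C.
  transitivity (C *m R *m C); first by rewrite CR.
  by rewrite -mulmxA row_col_base_idem mulmx1.
transitivity (R *m rG g *m (C *m R) *m rG h *m C); last by rewrite !mulmxA.
rewrite CR -(mulmxA _ e) e_comm // repr_mxM // -!mulmxA eC.
by rewrite !mulmxA.
Qed.

(** The image of [e] is invariant under [G], and the rank factorisation
    [e = C R] gives the matrices [R g C] of the restriction to it. *)
Lemma idempotent_char : exists2 phi : 'CF(G), phi \is a character
  & forall g, g \in G -> phi g = \tr (e *m rG g).
Proof.
exists (cfRepr (MxRepresentation idem_repr)); first exact: cfRepr_char.
move=> g Gg; rewrite cfunE Gg mulr1n /= mxtrace_mulC mulmxA.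
by rewrite mulmx_base.
Qed.

End IdempotentCharacter.

Lemma mxtrace_lin_mx d (f : {linear 'M[algC]_d -> 'M[algC]_d}) :
  \tr (lin_mx f) = \sum_i \sum_j f (delta_mx i j) i j.
Proof.
rewrite pair_big /= /mxtrace (reindex _ (curry_mxvec_bij d d)) /=.
by apply: eq_bigr => -[i j] _ /=; rewrite !mxE /= vec_mx_delta mxvecE.
Qed.

Lemma mulmx_rowP (F : fieldType) m n (A B : 'M[F]_(m, n)) :
  (forall u : 'rV_m, u *m A = u *m B) -> A = B.
Proof. by move=> eqAB; apply/row_matrixP=> i; rewrite !rowE. Qed.

Lemma mulmx_delta_entry (F : fieldType) d (A B : 'M[F]_d) i j k l :
  (B *m delta_mx i j *m A) k l = B k i * A j l.
Proof.
rewrite -(mul_delta_mx (0 : 'I_1)) mulmxA -colE -mulmxA -rowE mxE big_ord1.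
by rewrite !mxE.
Qed.

Section SquareRepresentation.

Variables (gT : finGroupType) (G : {group gT}) (d : nat).
Variables (rG : mx_representation algC G d) (eps : bool).

(* [G] acts on the bilinear forms, identified with their matrices. *)
Let act g : {linear 'M[algC]_d -> 'M[algC]_d} := mulmxr (rG g) \o mulmx (rG g)^T.
Let tau : 'M[algC]_(d * d) := lin_mx (@trmx algC d d).
Let e : 'M[algC]_(d * d) := 2%:R^-1 *: (1%:M + (-1) ^+ eps *: tau).

Fact form_repr : mx_repr G (fun g => lin_mx (act g)).
Proof.
split=> [|g h Gg Gh]; apply: mulmx_rowP => u; rewrite -(vec_mxK u).
  by rewrite mul_vec_lin mulmx1 /= repr_mx1 trmx1 mul1mx mulmx1.
by rewrite mulmxA !mul_vec_lin /= repr_mxM // trmx_mul !mulmxA.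
Qed.

Lemma mx_trmx_invol : tau *m tau = 1%:M.
Proof.
apply: mulmx_rowP => u; rewrite -(vec_mxK u) mulmxA !mul_vec_lin /= trmxK.
by rewrite mulmx1.
Qed.

(** On bilinear forms, the projection onto the symmetric or alternating ones
    commutes with the action of [G]. *)
Lemma square_char : exists2 phi : 'CF(G), phi \is a character
  & forall g, g \in G ->
      phi g = 2%:R^-1 * (\tr (rG g) ^+ 2 + (-1) ^+ eps * \tr (rG (g ^+ 2)%g)).
Proof.
have two : 2%:R != 0 :> algC by rewrite pnatr_eq0.
have tau_act g : tau *m lin_mx (act g) = lin_mx (act g) *m tau.
  apply: mulmx_rowP => u; rewrite -(vec_mxK u) !mulmxA !mul_vec_lin /=.
  by rewrite !trmx_mul trmxK !mulmxA.
have [|g Gg|phi char_phi phiE] := @idempotent_char _ G _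
    (MxRepresentation form_repr) e.
- rewrite /e; set u := _ *: tau.
  have uu : u *m u = 1%:M.
    by rewrite -scalemxAl -scalemxAr mx_trmx_invol scalerA -expr2 sqrr_sign scale1r.
  rewrite -scalemxAl -scalemxAr mulmxDl mul1mx mulmxDr mulmx1 uu.
  rewrite [u + _]addrC -mulr2n -scaler_nat !scalerA.
  by rewrite -?mulrA mulVf ?mulr1.
- rewrite /e /= -scalemxAl -scalemxAr mulmxDl mulmxDr mul1mx mulmx1.
  by rewrite -scalemxAl -scalemxAr tau_act.
exists phi => // g Gg; rewrite phiE // /e /= -scalemxAl mxtraceZ mulmxDl mul1mx.
rewrite mxtraceD -scalemxAl mxtraceZ; congr (_ * (_ + _ * _)).
  rewrite mxtrace_lin_mx /= expr2 /mxtrace mulr_suml; apply: eq_bigr => i _.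
  rewrite mulr_sumr; apply: eq_bigr => j _.
  by rewrite mulmx_delta_entry mxE.
pose act' : {linear 'M[algC]_d -> 'M[algC]_d} := act g \o @trmx _ d d.
have -> : tau *m lin_mx (act g) = lin_mx act'.
  by apply: mulmx_rowP => u; rewrite -(vec_mxK u) mulmxA !mul_vec_lin.
rewrite mxtrace_lin_mx expgS expg1 repr_mxM // /mxtrace; apply: eq_bigr => i _.
rewrite mxE; apply: eq_bigr => j _.
by rewrite /= trmx_delta mulmx_delta_entry mxE mulrC.
Qed.

End SquareRepresentation.

(** * The indicator of Frobenius and Schur *)

Section SquareCharacters.

Variables (gT : finGroupType) (G : {group gT}).

Lemma sym_squareE (chi : 'CF(G)) g : g \in G ->
  sym_square chi g = 2%:R^-1 * (chi g ^+ 2 + chi (g ^+ 2)%g).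
Proof. by move=> Gg; rewrite cfunE Gg mul1r. Qed.

Lemma alt_squareE (chi : 'CF(G)) g : g \in G ->
  alt_square chi g = 2%:R^-1 * (chi g ^+ 2 - chi (g ^+ 2)%g).
Proof. by move=> Gg; rewrite cfunE Gg mul1r. Qed.

Lemma sym_square_char (chi : 'CF(G)) :
  chi \is a character -> sym_square chi \is a character.
Proof.
case/char_reprP=> -[d rG] ->; have [phi char_phi phiE] := square_char rG false.
suff -> : sym_square (cfRepr rG) = phi by [].
apply/cfun_inP=> g Gg; rewrite sym_squareE // phiE // !cfunE groupX // Gg.
by rewrite !mulr1n expr0 mul1r.
Qed.

Lemma alt_square_char (chi : 'CF(G)) :
  chi \is a character -> alt_square chi \is a character.
Proof.
case/char_reprP=> -[d rG] ->; have [phi char_phi phiE] := square_char rG true.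
suff -> : alt_square (cfRepr rG) = phi by [].
apply/cfun_inP=> g Gg; rewrite alt_squareE // phiE // !cfunE groupX // Gg.
by rewrite !mulr1n expr1 mulN1r.
Qed.

End SquareCharacters.

Lemma mx_dim1_scalar r (A : 'M[algC]_r) : r = 1%N -> A = (\tr A)%:M.
Proof. by move=> r1; subst r; rewrite [A]mx11_scalar trace_mx11 mxE. Qed.

Section FrobeniusSchur.

Variables (gT : finGroupType) (G H : {group gT}) (i : Iirr G).
Hypothesis sHG : H \subset G.
Hypothesis chi_real : forall g, ('chi_i g)^* = 'chi_i g.
Hypothesis mult1 : '['Res[H] 'chi_i, 1] = 1.

Notation chi := ('chi_i).
Let rG := 'Chi_i.
Let d := irr_degree (socle_of_Iirr i).
Let E : 'M[algC]_d := #|H|%:R^-1 *: \sum_(h in H) rG h.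
Let f g := \tr (rG g *m E).

Lemma mxtrace_irr_repr g : g \in G -> \tr (rG g) = chi g.
Proof. by move=> Gg; rewrite -(irrRepr i) cfunE Gg. Qed.

Let H_neq0 : #|H|%:R != 0 :> algC.
Proof. by rewrite pnatr_eq0 -lt0n cardG_gt0. Qed.

Let memG h : h \in H -> h \in G := subsetP sHG h.

Lemma repr_mul_average h : h \in H -> rG h *m E = E.
Proof.
move=> Hh; rewrite /E -scalemxAr mulmx_sumr; congr (_ *: _).
rewrite [RHS](reindex_inj (mulgI h)) /=; apply: eq_big => [k|k Hk].
  by rewrite groupMl.
by rewrite repr_mxM // memG.
Qed.

Lemma average_idem : E *m E = E.
Proof.
rewrite {1}/E -scalemxAl mulmx_suml (eq_bigr (fun=> E)); last exact: repr_mul_average.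
by rewrite sumr_const -scaler_nat scalerA mulVf // scale1r.
Qed.

Lemma sphericalE g : g \in G -> f g = #|H|%:R^-1 * \sum_(h in H) chi (g * h)%g.
Proof.
move=> Gg; rewrite /f /E -scalemxAr mxtraceZ mulmx_sumr raddf_sum.
congr (_ * _); apply: eq_bigr => h Hh.
have Gh := memG Hh; rewrite -(mxtrace_irr_repr (groupM Gg Gh)). by rewrite repr_mxM.
Qed.

Lemma spherical1 : f 1%g = 1.
Proof.
rewrite sphericalE // -[RHS]mult1 cfdotE; congr (_ * _); apply: eq_bigr => h Hh.
by rewrite cfun1E Hh rmorph1 mulr1 cfResE // mul1g.
Qed.

Lemma spherical_real g : g \in G -> f g \is Num.real.
Proof.
move=> Gg; rewrite sphericalE // rpredM ?rpredV ?rpred_nat // rpred_sum // => h _.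
by apply/CrealP; apply: chi_real.
Qed.

(** The multiplicity 1 says that the idempotent [E] has trace 1, hence rank 1. *)
Lemma average_sandwich g : E *m rG g *m E = f g *: E.
Proof.
have CR : col_base E *m row_base E = E by apply: mulmx_base.
have rank1 : \rank E = 1%N.
  have := spherical1; rewrite /f repr_mx1 mul1mx -{1}CR mxtrace_mulC.
  rewrite (row_col_base_idem average_idem) mxtrace1 => /eqP.
  by rewrite (eqr_nat _ _ 1) => /eqP.
transitivity (col_base E *m (row_base E *m rG g *m col_base E) *m row_base E).
  transitivity (col_base E *m row_base E *m rG g *m (col_base E *m row_base E)).
    by rewrite CR.
  by rewrite !mulmxA.
rewrite [X in _ *m X *m _](mx_dim1_scalar _ rank1) mul_mx_scalar -scalemxAl CR; congr (_ *: _).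
by rewrite mxtrace_mulC mulmxA CR mxtrace_mulC.
Qed.

Let Z : 'M[algC]_d := \sum_(g in G) rG (g ^+ 2)%g.

Lemma sum_squares_scalar : is_scalar_mx Z.
Proof.
apply: (mx_abs_irr_cent_scalar (groupC (socle_irr _))).
apply/centgmxP=> h Gh; rewrite mulmx_suml mulmx_sumr.
rewrite [RHS](reindex_inj (conjg_inj h)) /=; apply: eq_big => [g|g Gg].
  by rewrite groupJr.
rewrite -!repr_mxM ?groupX ?groupJ // -conjXg conjgE.
by rewrite !mulgA mulgV mul1g.
Qed.

(** For [h] in [H] one has [g h g = (g h)^2 h^-1]: summed over [g], this turns
    the average [E] into the product of [E] by the scalar matrix [Z]. *)
Lemma sum_average_conj : \sum_(g in G) rG g *m E *m rG g = Z *m E.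
Proof.
have inner h : h \in H -> \sum_(g in G) rG g *m rG h *m rG g = Z *m rG h^-1%g.
  move=> Hh; have Gh := memG Hh.
  rewrite mulmx_suml [RHS](reindex_inj (mulIg h)) /=; apply: eq_big => [g|g Gg].
    by rewrite groupMr.
  rewrite -!repr_mxM ?groupX ?groupM ?groupV //; congr (rG _).
  by rewrite expgS expg1 !mulgA mulgK.
transitivity (#|H|%:R^-1 *: \sum_(h in H) \sum_(g in G) rG g *m rG h *m rG g).
  rewrite exchange_big scaler_sumr; apply: eq_bigr => g Gg.
  rewrite /E -scalemxAr -scalemxAl; congr (_ *: _).
  by rewrite mulmx_sumr mulmx_suml.
rewrite (eq_bigr _ inner) -mulmx_sumr scalemxAr; congr (_ *m (_ *: _)).
rewrite (reindex_inj invg_inj) /=; apply: eq_big => [h|h Hh].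
  by rewrite groupV.
by rewrite invgK.
Qed.

(** The scalar matrix [Z] is [z], with [z = tr (Z E) = sum of tr (g E g E)], and
    the rank 1 of [E] makes each summand the square of the real number [f g]. *)
Lemma frobenius_schur_gt0 : 0 < \sum_(g in G) chi (g ^+ 2)%g.
Proof.
have [z defZ] := is_scalar_mxP sum_squares_scalar.
have trE : \tr E = 1 by rewrite -spherical1 /f repr_mx1 mul1mx.
have sum_f : z = \sum_(g in G) f g ^+ 2.
  transitivity (\tr (Z *m E *m E)).
    by rewrite -mulmxA average_idem defZ mul_scalar_mx mxtraceZ trE mulr1.
  rewrite -sum_average_conj mulmx_suml raddf_sum; apply: eq_bigr => g Gg.
  transitivity (\tr (rG g *m (E *m rG g *m E))); first by rewrite !mulmxA.
  by rewrite average_sandwich -scalemxAr mxtraceZ expr2.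
have z_gt0 : 0 < z.
  rewrite sum_f (bigD1 1%g) //= spherical1 expr1n ltr_wpDr ?ltr01 //.
  by apply: sumr_ge0 => g /andP [Gg _]; rewrite real_exprn_even_ge0 ?spherical_real.
have <- : \tr Z = \sum_(g in G) chi (g ^+ 2)%g.
  rewrite raddf_sum; apply: eq_bigr => g Gg; exact: (mxtrace_irr_repr (groupX 2 Gg)).
by rewrite defZ mxtrace_scalar pmulrn_lgt0 // irr_degree_gt0.
Qed.

(** The indicator is positive, and it is the difference of the multiplicities
    of the trivial character in the symmetric and in the alternating square,
    which add up to 1. *)
Theorem frobenius_schur_eq1 : #|G|%:R^-1 * \sum_(g in G) chi (g ^+ 2)%g = 1.
Proof.
have [chS chA] := (sym_square_char (irr_char i), alt_square_char (irr_char i)).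
have /natrP [s def_s] := Cnat_cfdot_char chS (cfun1_char G).
have /natrP [t def_t] := Cnat_cfdot_char chA (cfun1_char G).
have dot1 (phi : 'CF(G)) : '[phi, 1] = #|G|%:R^-1 * \sum_(g in G) phi g.
  rewrite cfdotE; congr (_ * _); apply: eq_bigr => g Gg.
  by rewrite cfun1E Gg rmorph1 mulr1.
have two : 2%:R != 0 :> algC by rewrite pnatr_eq0.
have sum_st : (s + t)%:R = 1 :> algC.
  rewrite natrD -def_s -def_t !dot1 -mulrDr -big_split /= -[RHS](cfnorm_irr i).
  rewrite cfdotE; congr (_ * _); apply: eq_bigr => g Gg.
  rewrite sym_squareE // alt_squareE // -mulrDr addrACA subrr addr0 chi_real.
  by rewrite -mulr2n -[_ ^+ 2 *+ 2]mulr_natl mulKf.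
have diff_st : s%:R - t%:R = #|G|%:R^-1 * \sum_(g in G) chi (g ^+ 2)%g.
  rewrite -def_s -def_t !dot1 -mulrBr -sumrB.
  congr (_ * _); apply: eq_bigr => g Gg.
  rewrite sym_squareE // alt_squareE // -mulrBr opprB [_ ^+ 2 + _]addrC.
  rewrite addrACA subrr addr0.
  by rewrite -mulr2n -['chi_i _ *+ 2]mulr_natl mulKf.
have st1 : (s + t = 1)%N by apply/eqP; rewrite -(eqr_nat algC) sum_st.
have lt_ts : (t < s)%N.
  rewrite -(ltr_nat algC) -subr_gt0 diff_st mulr_gt0 ?frobenius_schur_gt0 //.
  by rewrite invr_gt0 ltr0n cardG_gt0.
rewrite -diff_st; have [-> ->] : (s = 1 /\ t = 0)%N by lia.
by rewrite subr0.
Qed.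

End FrobeniusSchur.

(** * Removing rim hooks from a rectangle *)

(** On [frob], subtracting [k] from an entry removes a rim hook of length [k]
    from the diagram, up to sign: this is the rule of Murnaghan and Nakayama. *)
Definition hook l (k : nat) (F : ('I_l -> int) -> algC) (u : 'I_l -> int) : algC :=
  \sum_i F (fun j => u j - ((j == i) * k)%N%:Z).

(** The effect on [v] of restricting [frob v] to the coset of a Young subgroup
    defined by the permutation [y] of the second block, see [frob_psum]. *)
Definition word_op l k (y : 'S_k) (F : ('I_l -> int) -> algC) (u : 'I_l -> int) :=
  \sum_(d : {ffun 'I_k -> 'I_l} | fixes y d) F (fun i => u i - (content d i)%:Z).

Lemma hook_alternating l k (F : ('I_l -> int) -> algC) :
  alternating F -> alternating (hook k F).
Proof.
move=> [Fext Falt]; split=> [u u' eq_u|s u].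
  by apply: eq_bigr => i _; apply: Fext => j; rewrite eq_u.
rewrite /hook mulr_sumr [RHS](reindex_inj (@perm_inj _ s)); apply: eq_bigr => i _.
by rewrite -Falt; apply: Fext => j; rewrite (inj_eq perm_inj).
Qed.

Section WordOp.

Variables (l : nat) (F : ('I_l -> int) -> algC).
Hypothesis F_alt : alternating F.

Lemma word_op_psum m k (x : 'S_m) (y : 'S_k) u :
  word_op (psum x y) F u = word_op x (word_op y F) u.
Proof.
rewrite /word_op (reindex _ (onW_bij _ (cat_word_bij m k l))) /=.
rewrite [RHS]pair_big /=; apply: eq_big => [p|p _]; first by rewrite fixes_cat.
by apply: F_alt.1 => i; rewrite content_cat PoszD opprD addrA.
Qed.

Lemma word_opJ k (y h : 'S_k) u : word_op (y ^ h)%g F u = word_op y F u.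
Proof.
rewrite /word_op [RHS](reindex _ (onW_bij _ (comp_ffun_bij l h))) /=.
apply: eq_big => [d|d _]; last by apply: F_alt.1 => i; rewrite content_comp.
apply/forallP/forallP=> gd x.
  by have:= gd (h x); rewrite !ffunE conjgE !permM permK.
have:= gd (h^-1 x)%g; rewrite !ffunE permKV => /eqP <-.
by rewrite conjgE !permM.
Qed.

(** A cycle fixes the constant words only. *)
Lemma word_op_cycle k (y : 'S_k.+1) u :
    (forall d : {ffun 'I_k.+1 -> 'I_l}, fixes y d -> forall x, d x = d ord0) ->
  word_op y F u = hook k.+1 F u.
Proof.
move=> cycle_y; rewrite /word_op.
rewrite (reindex_onto (fun i : 'I_l => [ffun _ : 'I_k.+1 => i])
                      (fun d => d ord0)) /=; last first.
  by move=> d /cycle_y const_d; apply/ffunP=> x; rewrite ffunE const_d.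
apply: eq_big => [i|i _].
  by rewrite ffunE eqxx andbT; apply/forallP=> x; rewrite !ffunE.
apply: F_alt.1 => j; congr (_ - Posz _); rewrite /content.
under eq_bigr do rewrite ffunE.
by rewrite sum_nat_const card_ord mulnC eq_sym.
Qed.

End WordOp.

Section Rectangle.

Variables (a b : nat) (F : ('I_b.+3 -> int) -> algC).
Hypothesis F_alt : alternating F.

(** The strictly decreasing sequence attached to the rectangle, with its three
    last entries replaced; positions are counted from the end. *)
Definition vec_val (x y z : int) (j : nat) : int :=
  if j is j'.+1 then
    if j' is j''.+1 then if j'' is _.+1 then (a + j)%N%:Z else z else y
  else x.

Definition vec x y z (i : 'I_b.+3) : int := vec_val x y z (rev_ord i).

Let o0 : 'I_b.+3 := rev_ord ord0.
Let o1 : 'I_b.+3 := rev_ord (lift ord0 ord0).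
Let o2 : 'I_b.+3 := rev_ord (lift ord0 (lift ord0 ord0)).

Lemma vec_swap01 x y z : F (vec y x z) = - F (vec x y z).
Proof.
have ne : o0 != o1 by rewrite (inj_eq rev_ord_inj).
rewrite -(alternating_swap _ F_alt ne); apply: F_alt.1 => i; rewrite /vec.
case: tpermP => [->|->|]; rewrite ?rev_ordK //.
rewrite -[i in i <> o0]rev_ordK -[i in i <> o1]rev_ordK.
case: (rev_ord i) => -[|[|j]] lt_j //= ne0 ne1.
  by case: ne0; congr rev_ord; apply: val_inj.
by case: ne1; congr rev_ord; apply: val_inj.
Qed.

Lemma vec_swap12 x y z : F (vec x z y) = - F (vec x y z).
Proof.
have ne : o1 != o2 by rewrite (inj_eq rev_ord_inj).
rewrite -(alternating_swap _ F_alt ne); apply: F_alt.1 => i; rewrite /vec.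
case: tpermP => [->|->|]; rewrite ?rev_ordK //.
rewrite -[i in i <> o1]rev_ordK -[i in i <> o2]rev_ordK.
case: (rev_ord i) => -[|[|[|j]]] lt_j //= ne0 ne1.
  by case: ne0; congr rev_ord; apply: val_inj.
by case: ne1; congr rev_ord; apply: val_inj.
Qed.

Lemma vec_eq01 x z : F (vec x x z) = 0.
Proof.
apply: (@alternating_eq0 _ _ _ o0 o1 F_alt); first by rewrite (inj_eq rev_ord_inj).
by rewrite /vec !rev_ordK.
Qed.

Lemma vec_eq12 x y : F (vec x y y) = 0.
Proof.
apply: (@alternating_eq0 _ _ _ o1 o2 F_alt); first by rewrite (inj_eq rev_ord_inj).
by rewrite /vec !rev_ordK.
Qed.

(** Removing a rim hook of length [k] from any row above the last three makes
    two entries equal. *)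
Lemma hook_vec k (x y z : int) : (0 < k <= 3)%N ->
    (forall j, (3 - k <= j < 3)%N -> vec_val x y z j = (a + j)%N%:Z) ->
  hook k F (vec x y z) = F (vec (x - k%:Z) y z) + F (vec x (y - k%:Z) z)
                         + F (vec x y (z - k%:Z)).
Proof.
move=> /andP [k_gt0 k_le3] Hk; rewrite /hook (reindex_inj rev_ord_inj) /=.
rewrite 3!big_ord_recl big1 ?addr0 => [|j _]; last first.
  set i := rev_ord _; pose j0 := (j.+3 - k)%N.
  have lt_j0 : (j0 < b.+3)%N by rewrite /j0; have := ltn_ord j; lia.
  have ne_i : i != rev_ord (Ordinal lt_j0).
    by rewrite (inj_eq rev_ord_inj) -val_eqE /= /bump /= /j0; lia.
  apply: (alternating_eq0 F_alt ne_i).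
  rewrite eqxx mul1n eq_sym (negbTE ne_i) mul0n subr0 /vec !rev_ordK /=.
  have -> : vec_val x y z j0 = (a + j0)%N%:Z.
    have [lt3|ge3] := ltnP j0 3; first by apply: Hk; rewrite /j0 in lt3 *; lia.
    by case: (j0) ge3 => [|[|[|?]]].
  by rewrite /j0 /= /bump /=; lia.
rewrite addrA; congr (_ + _ + _); apply: F_alt.1 => i; rewrite /vec;
  rewrite -(inj_eq rev_ord_inj) rev_ordK;
  case: (rev_ord i) => -[|[|[|j]]] lt_j; rewrite -val_eqE /= ?mul1n ?subr0 //.
Qed.

Notation A := (a%:Z).
(* The rectangle with one, two or three cells removed: [W] for one cell; [U] and
   [V] for two cells, in the same row or in the same column; [P], [Q] and [R] for
   a row of three cells, an angle and a column of three cells. *)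
Notation W := (vec (A - 1) (A + 1) (A + 2)).
Notation U := (vec (A - 2) (A + 1) (A + 2)).
Notation V := (vec (A - 1) A (A + 2)).
Notation P := (vec (A - 3) (A + 1) (A + 2)).
Notation Q := (vec (A - 2) A (A + 2)).
Notation R := (vec (A - 1) A (A + 1)).

Let hook_vecE k x y z x' y' z' x1 y1 z1 : (0 < k <= 3)%N ->
    (forall j, (3 - k <= j < 3)%N -> vec_val x y z j = (a + j)%N%:Z) ->
    [/\ x' = x, y' = y & z' = z] ->
    [/\ x - k%:Z = x1, y - k%:Z = y1 & z - k%:Z = z1] ->
  hook k F (vec x' y' z') = F (vec x1 y z) + F (vec x y1 z) + F (vec x y z1).
Proof. by move=> k3 Hk [-> -> ->] [<- <- <-]; apply: hook_vec. Qed.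

Lemma hook1_rect : hook 1 F (vec A (A + 1) (A + 2)) = F W.
Proof.
rewrite (@hook_vecE 1 A (A + 1) (A + 2) _ _ _ (A - 1) A (A + 1)) //.
- by rewrite vec_eq01 vec_eq12 !addr0.
- by move=> [|[|[|j]]] //=; lia.
- by split; lia.
Qed.

Lemma hook1_W : hook 1 F W = F U + F V.
Proof.
rewrite (@hook_vecE 1 (A - 1) (A + 1) (A + 2) _ _ _ (A - 2) A (A + 1)) //.
- by rewrite vec_eq12 addr0.
- by move=> [|[|[|j]]] //=; lia.
- by split; lia.
Qed.

Lemma hook1_U : hook 1 F U = F P + F Q.
Proof.
rewrite (@hook_vecE 1 (A - 2) (A + 1) (A + 2) _ _ _ (A - 3) A (A + 1)) //.
- by rewrite vec_eq12 addr0.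
- by move=> [|[|[|j]]] //=; lia.
- by split; lia.
Qed.

Lemma hook1_V : hook 1 F V = F Q + F R.
Proof.
rewrite (@hook_vecE 1 (A - 1) A (A + 2) _ _ _ (A - 2) (A - 1) (A + 1)) //.
- by rewrite vec_eq01 addr0.
- by move=> [|[|[|j]]] //=; lia.
- by split; lia.
Qed.

Lemma hook2_rect : hook 2 F (vec A (A + 1) (A + 2)) = F U - F V.
Proof.
rewrite (@hook_vecE 2 A (A + 1) (A + 2) _ _ _ (A - 2) (A - 1) A) //.
- rewrite (vec_swap01 (A - 1) A) (vec_swap12 A A) vec_eq01 oppr0 addr0.
  by [].
- by move=> [|[|[|j]]] //=; lia.
- by split; lia.
Qed.

Lemma hook3_rect : hook 3 F (vec A (A + 1) (A + 2)) = F P - F Q + F R.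
Proof.
rewrite (@hook_vecE 3 A (A + 1) (A + 2) _ _ _ (A - 3) (A - 2) (A - 1)) //.
- rewrite (vec_swap01 (A - 2) A) (vec_swap12 A (A - 1)).
  by rewrite (vec_swap01 (A - 1) A (A + 1)) opprK.
- by move=> [|[|[|j]]] //=; lia.
- by split; lia.
Qed.

End Rectangle.

(** * Averages over symmetric groups of degree at most 3 *)

Definition block_avg m k (phi : 'S_(m + k) -> algC) (y : 'S_k) : algC :=
  m`!%:R^-1 * \sum_(x : 'S_m) phi (psum x y).

Lemma row_avg_block m k mu (phi : 'S_(m + k) -> algC) :
  row_avg (m :: mu) phi = row_avg mu (block_avg phi).
Proof. by rewrite row_avg_cons /block_avg row_avg_scale row_avg_sum. Qed.

Lemma psum1 m k : psum 1 1 = 1%g :> 'S_(m + k).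
Proof.
by apply/permP=> i; case: (split_ordP i) => j ->;
  rewrite ?psum_lshift ?psum_rshift !perm1.
Qed.

Lemma block_avgJ m k (phi : 'S_(m + k) -> algC) :
    (forall g h, phi (g ^ h)%g = phi g) ->
  forall y h, block_avg phi (y ^ h)%g = block_avg phi y.
Proof.
move=> phiJ y h; congr (_ * _); apply: eq_bigr => x _.
rewrite -[RHS](phiJ _ (psum 1 h)); congr phi; rewrite !conjgE.
have -> : ((psum 1 h)^-1 = psum 1 h^-1 :> 'S_(m + k))%g.
  by apply/eqP; rewrite eq_invg_mul psumM mulgV mulg1 psum1.
by rewrite !psumM mul1g mulg1.
Qed.

Lemma row_avg_column n (phi : 'S_n -> algC) : row_avg (nseq n 1%N) phi = phi 1%g.
Proof. by rewrite /row_avg row_stab_column cards1 invr1 mul1r big_set1. Qed.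

Lemma row_avg_row n (phi : 'S_n -> algC) :
  row_avg [:: n] phi = n`!%:R^-1 * \sum_g phi g.
Proof.
have R : row_stab n [:: n] = [set: 'S_n] :> {set 'S_n}.
  apply/setP=> g; rewrite row_stabE inE; apply/forallP=> x.
  by rewrite !reshape_index_cons !ltn_ord.
rewrite /row_avg R cardsT card_Sn; congr (_ * _).
by apply: eq_bigl => g; rewrite inE.
Qed.

Lemma sum_uniq_full (T : finType) (s : seq T) (F : T -> algC) :
  uniq s -> size s = #|T| -> \sum_x F x = \sum_(x <- s) F x.
Proof.
move=> us size_s; rewrite [RHS]big_uniq //; apply: eq_bigl => x.
apply/esym/(subset_cardP _ (subset_predT (mem s))).
by rewrite (card_uniqP us) size_s.
Qed.

Definition swap2 : 'S_2 := tperm ord0 ord_max.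

Lemma swap2_sqr : (swap2 ^+ 2 = 1)%g.
Proof. by rewrite expgS expg1 tperm2. Qed.

Lemma sum_S2 (phi : 'S_2 -> algC) : \sum_y phi y = phi 1%g + phi swap2.
Proof.
rewrite (@sum_uniq_full _ [:: 1%g; swap2]) ?card_Sn //.
  by rewrite !big_cons big_nil addr0.
rewrite /= inE andbT; apply/eqP=> /permP /(_ ord0).
by rewrite tpermL perm1.
Qed.

Lemma row_avg_S2 (phi : 'S_2 -> algC) :
  row_avg [:: 2%N] phi = 2%:R^-1 * (phi 1%g + phi swap2).
Proof. by rewrite row_avg_row sum_S2. Qed.

Section S3.

Let o0 : 'I_3 := @Ordinal 3 0 isT.
Let o1 : 'I_3 := @Ordinal 3 1 isT.
Let o2 : 'I_3 := @Ordinal 3 2 isT.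

Definition swap3 : 'S_3 := tperm o0 o1.
Definition cycle3 : 'S_3 := (tperm o0 o1 * tperm o1 o2)%g.

Lemma swap3E : swap3 = psum swap2 (1 : 'S_1) :> 'S_(2 + 1).
Proof.
apply/permP=> i; apply/val_inj; case: (split_ordP i) => j ->; last first.
  by rewrite psum_rshift perm1 [j]ord1 /= permE.
by rewrite psum_lshift !permE; case: j => -[|[|j]] lt_j.
Qed.

Lemma fixes_cycle3 l (d : {ffun 'I_3 -> 'I_l}) :
  fixes cycle3 d -> forall x, d x = d ord0.
Proof.
move/forallP=> fix_d.
have c0 : cycle3 o0 = o2 by apply: val_inj; rewrite permM !permE.
have c2 : cycle3 o2 = o1 by apply: val_inj; rewrite permM !permE.
have d2 : d o2 = d o0 by rewrite -c0; apply/eqP.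
have d1 : d o1 = d o0 by rewrite -c2 -d2; apply/eqP.
have e0 : ord0 = o0 by apply: val_inj.
move=> x; rewrite e0; case: x => -[|[|[|x]]] lt_x //.
- by congr (d _); apply: val_inj.
- by rewrite -d1; congr (d _); apply: val_inj.
- by rewrite -d2; congr (d _); apply: val_inj.
Qed.

Variable phi : 'S_3 -> algC.
Hypothesis phiJ : forall g h, phi (g ^ h)%g = phi g.

Lemma cycle3_sqr : phi (cycle3 ^+ 2)%g = phi cycle3.
Proof.
rewrite -[RHS](phiJ _ (tperm o0 o1)); congr phi.
by apply/permP=> -[[|[|[|x]]] lt_x] //; apply: val_inj;
  rewrite expgS expg1 conjgE tpermV !permM !permE.
Qed.

Lemma swap3_sqr : (swap3 ^+ 2 = 1)%g.
Proof. by rewrite expgS expg1 tperm2. Qed.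

Lemma phi_swap12 : phi (tperm o1 o2) = phi swap3.
Proof. by rewrite -[RHS](phiJ _ (tperm o0 o2)) tpermJ tpermL tpermD // tpermC. Qed.

Lemma phi_swap02 : phi (tperm o0 o2) = phi swap3.
Proof. by rewrite -[RHS](phiJ _ (tperm o1 o2)) tpermJ tpermL tpermD. Qed.

Lemma row_avg_S3 :
  row_avg [:: 3%N] phi = 6%:R^-1 * (phi 1%g + 3%:R * phi swap3 + 2%:R * phi cycle3).
Proof.
rewrite row_avg_row; congr (_ * _).
rewrite (@sum_uniq_full _ [:: 1%g; swap3; tperm o1 o2; tperm o0 o2;
                             cycle3; (cycle3 ^+ 2)%g]) ?card_Sn //.
  rewrite !big_cons big_nil addr0 phi_swap12 phi_swap02 cycle3_sqr.
  by ring.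
apply: (map_uniq (f := fun y : 'S_3 => (val (y o0), val (y o1)))).
by rewrite /= !(expgS, expg1, permM, permE).
Qed.

Lemma row_avg_S21 :
  row_avg [:: 2%N; 1%N] phi = 2%:R^-1 * (phi 1%g + phi swap3).
Proof.
rewrite (@row_avg_cons 2 1) sum_S2; congr (_ * (_ + _)).
  by rewrite (@row_avg_column 1) psum1.
by rewrite (@row_avg_column 1) swap3E.
Qed.

End S3.

(** * Small permutations acting on words; orthonormality and indicators *)

Section SmallWordOps.

Variables (l : nat) (F : ('I_l -> int) -> algC).
Hypothesis F_alt : alternating F.

Lemma word_op_S1 (G : ('I_l -> int) -> algC) u : alternating G ->
  word_op (1%g : 'S_1) G u = hook 1 G u.
Proof. by move=> G_alt; apply: word_op_cycle => // d _ x; rewrite [x]ord1. Qed.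

Lemma word_op_swap2 (G : ('I_l -> int) -> algC) u : alternating G ->
  word_op swap2 G u = hook 2 G u.
Proof.
move=> G_alt; apply: word_op_cycle => // d /forallP fix_d x.
have := fix_d ord0; rewrite tpermL => /eqP d1.
by case: x => -[|[|x]] lt_x //; [|rewrite -d1]; congr (d _); apply: val_inj.
Qed.

Lemma eq_word_op k (y : 'S_k) (G G' : ('I_l -> int) -> algC) u :
  (forall w, G w = G' w) -> word_op y G u = word_op y G' u.
Proof. by move=> eqG; apply: eq_bigr => d _; apply: eqG. Qed.

Lemma word_op_S2_1 u : word_op (1%g : 'S_2) F u = hook 1 (hook 1 F) u.
Proof.
rewrite -(@psum1 1 1) (@word_op_psum _ _ F_alt 1 1) (@eq_word_op _ _ _ (hook 1 F)).
  by apply: word_op_S1; apply: hook_alternating.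
by move=> w; apply: word_op_S1.
Qed.

Lemma word_op_S3_1 u : word_op (1%g : 'S_3) F u = hook 1 (hook 1 (hook 1 F)) u.
Proof.
rewrite -(@psum1 1 2) (@word_op_psum _ _ F_alt 1 2) (@eq_word_op _ _ _ (hook 1 (hook 1 F))).
  by apply: word_op_S1; do 2!apply: hook_alternating.
exact: word_op_S2_1.
Qed.

Lemma word_op_swap3 u : word_op swap3 F u = hook 2 (hook 1 F) u.
Proof.
rewrite swap3E (word_op_psum F_alt swap2 (1%g : 'S_1)).
rewrite (@eq_word_op _ _ _ (hook 1 F)).
  by apply: word_op_swap2; apply: hook_alternating.
by move=> w; apply: word_op_S1.
Qed.

Lemma word_op_cycle3 u : word_op cycle3 F u = hook 3 F u.
Proof. by apply: word_op_cycle => //; apply: fixes_cycle3. Qed.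

Lemma word_op_cycle3_sqr u : word_op (cycle3 ^+ 2)%g F u = hook 3 F u.
Proof.
rewrite (@cycle3_sqr (fun y => word_op y F u)) ?word_op_cycle3 // => g h.
exact: word_opJ.
Qed.

End SmallWordOps.

Section Orthonormal.

Variables (m l : nat).

Definition is_shape (la : seq nat) :=
  [&& sorted geq la, sumn la == m & size la == l].

Let f la (x : 'S_m) := frob (@betaz l la) x.

Lemma frob_irrl la : is_shape la -> exists i, frob_cfun m (@betaz l la) = 'chi_i.
Proof. by case/and3P=> sort_la /eqP sum_la /eqP <-; apply: frob_irr. Qed.

Lemma frob_spechtl la : is_shape la ->
  frob_cfun m (@betaz l la) = specht_char m (nonzero_rows la).
Proof. by case/and3P=> sort_la /eqP sum_la /eqP <-; apply: frob_specht. Qed.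

Lemma frob_orthonormal la la' : is_shape la -> is_shape la' ->
  m`!%:R^-1 * \sum_x f la x * f la' x = (la == la')%:R.
Proof.
move=> sh sh'; have [i def_i] := frob_irrl sh; have [j def_j] := frob_irrl sh'.
transitivity '[frob_cfun m (@betaz l la), frob_cfun m (@betaz l la')].
  rewrite cfdot_Sn; congr (_ * _); apply: eq_bigr => x _.
  by rewrite !frob_cfunE frob_real.
rewrite def_i def_j cfdot_irr; congr (_%:R); congr nat_of_bool.
apply/eqP/eqP=> [eq_ij|eq_la]; last first.
  by apply: irr_inj; rewrite -def_i -def_j eq_la.
have := congr1 (fun i => 'chi_i) eq_ij; rewrite -def_i -def_j !frob_spechtl //.
case/and3P: sh sh' => sort_la /eqP sum_la /eqP size_la.
case/and3P=> sort_la' /eqP sum_la' /eqP size_la' eq_s.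
apply: nonzero_rows_inj => //; first by rewrite size_la.
by apply: specht_inj eq_s; apply: nonzero_rows_partition.
Qed.

(** The values are real, and the trivial character of the row stabiliser occurs
    once in the restriction, by [row_avg_frob_diag]. *)
Lemma frob_indicator la : is_shape la ->
  m`!%:R^-1 * \sum_x f la (x ^+ 2)%g = 1.
Proof.
case/and3P=> sort_la /eqP sum_la /eqP size_la.
have [i def_i] := frob_irr sort_la sum_la; rewrite size_la in def_i.
have fE g : 'chi_i g = f la g by rewrite -def_i frob_cfunE.
have sumT (phi : 'S_m -> algC) : \sum_x phi x = \sum_(x in [set: 'S_m]) phi x.
  by apply: eq_bigl => x; rewrite inE.
rewrite -cards_Sn sumT (eq_bigr (fun x => 'chi_i (x ^+ 2)%g)) => [|x _ //].
apply: (@frobenius_schur_eq1 _ _ (row_stab m la)); first exact: subsetT.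
  by move=> g; rewrite fE frob_real.
rewrite cfdot_Res_l -row_avg_cfdot (eq_row_avg _ fE).
by apply: row_avg_frob_diagE; rewrite ?size_la.
Qed.

Variables (S : seq (seq nat)) (c : nat -> algC) (theta : 'S_m -> algC).
Hypotheses (S_shape : all is_shape S) (S_uniq : uniq S).
Hypothesis thetaE :
  forall x, theta x = \sum_(j < size S) c j * f (nth [::] S j) x.

Let nth_shape (j : 'I_(size S)) : is_shape (nth [::] S j).
Proof. by apply: (allP S_shape); apply: mem_nth. Qed.

Lemma avg_combination_sqr :
  m`!%:R^-1 * \sum_x theta x ^+ 2 = \sum_(j < size S) c j ^+ 2.
Proof.
transitivity (\sum_(j < size S) \sum_(k < size S) c j * c k *
  (m`!%:R^-1 * \sum_x f (nth [::] S j) x * f (nth [::] S k) x)).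
  rewrite mulr_sumr; under [RHS]eq_bigr do under eq_bigr do
    rewrite mulrCA mulr_sumr mulr_sumr.
  under [RHS]eq_bigr do rewrite exchange_big.
  rewrite [RHS]exchange_big; apply: eq_bigr => x _.
  rewrite thetaE expr2 mulr_suml mulr_sumr; apply: eq_bigr => j _.
  rewrite mulr_sumr mulr_sumr; apply: eq_bigr => k _.
  by ring.
apply: eq_bigr => j _; rewrite (bigD1 j) //= frob_orthonormal // eqxx mulr1.
rewrite big1 ?addr0 // => k ne_kj; rewrite frob_orthonormal //.
by rewrite nth_uniq // eq_sym (inj_eq val_inj) (negbTE ne_kj) mulr0.
Qed.

Lemma avg_combination_indicator :
  m`!%:R^-1 * \sum_x theta (x ^+ 2)%g = \sum_(j < size S) c j.
Proof.
under eq_bigr do rewrite thetaE.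
rewrite exchange_big mulr_sumr; apply: eq_bigr => j _.
by rewrite -mulr_sumr mulrCA frob_indicator // mulr1.
Qed.

End Orthonormal.

(** * The squares of the character of a rectangle, averaged over a block *)

Section RectangleAverages.

Variables (a b : nat).
Hypothesis a_ge3 : (3 <= a)%N.

Notation rect := (nseq b.+3 a).
Definition shape3 p q r : seq nat := nseq b a ++ [:: p; q; r].

Lemma betaz_shape3 p q r :
  @betaz b.+3 (shape3 p q r) =1 vec a r%:Z (q%:Z + 1) (p%:Z + 2).
Proof.
move=> i; rewrite /betaz /beta /shape3 /vec nth_cat size_nseq nth_nseq.
have def_i : nat_of_ord i = (b.+2 - rev_ord i)%N by have := ltn_ord i; rewrite /=; lia.
rewrite def_i; case: (rev_ord i) => -[|[|[|j]]] lt_j /=.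
- have [-> ->] : ((b.+2 - 0 < b) = false /\ b.+2 - 0 - b = 2)%N by lia.
  by rewrite /=; lia.
- have [-> ->] : ((b.+2 - 1 < b) = false /\ b.+2 - 1 - b = 1)%N by lia.
  by rewrite /=; lia.
- have [-> ->] : ((b.+2 - 2 < b) = false /\ b.+2 - 2 - b = 0)%N by lia.
  by rewrite /=; lia.
have -> : (b.+2 - j.+3 < b)%N by lia.
by rewrite /=; lia.
Qed.

Lemma betaz_rect : @betaz b.+3 rect =1 vec a a%:Z (a%:Z + 1) (a%:Z + 2).
Proof.
move=> i; rewrite -betaz_shape3; congr betaz.
by rewrite /shape3 -[b.+3]addn3 nseqD.
Qed.

Lemma is_shape3 m p q r : (r <= q <= p)%N -> (p <= a)%N ->
  (b * a + p + q + r = m)%N -> is_shape m b.+3 (shape3 p q r).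
Proof.
move=> /andP [le_rq le_qp] le_pa sum_m; apply/and3P; split.
- rewrite /shape3; elim: b => [|b' IHb] /=; first by rewrite le_qp le_rq.
  by case: b' IHb => [|b'] /= -> /=; rewrite ?le_pa ?leqnn.
- by rewrite /shape3 sumn_cat sumn_nseq /=; apply/eqP; lia.
by rewrite /shape3 size_cat size_nseq addn3.
Qed.

Lemma frob_shape3 m (x : 'S_m) p q r (x1 y1 z1 : int) :
    x1 = r%:Z -> y1 = q%:Z + 1 -> z1 = p%:Z + 2 ->
  frob (@vec a b x1 y1 z1) x = frob (@betaz b.+3 (shape3 p q r)) x.
Proof.
by move=> -> -> ->; apply: (frob_alternating _ x).1 => i; rewrite betaz_shape3.
Qed.

Section Block.

Variables m k : nat.
Hypothesis size_rect : (a * b.+3 = m + k)%N.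

Notation chi := (frob_cfun (m + k) (@betaz b.+3 rect)).
Let F (x : 'S_m) (u : 'I_b.+3 -> int) := frob u x.
Let F_alt x : alternating (F x). Proof. exact: frob_alternating. Qed.

Lemma rect_psum x (y : 'S_k) :
  chi (psum x y) = word_op y (F x) (vec a a%:Z (a%:Z + 1) (a%:Z + 2)).
Proof.
rewrite frob_cfunE frob_psum; apply: eq_bigr => d _.
by apply: (F_alt x).1 => i; rewrite betaz_rect.
Qed.

(** If the restrictions of [chi] to the cosets of the first block at [y] and at
    [y ^+ 2] are combinations of irreducible characters, then orthonormality
    evaluates the average of [chi g ^+ 2], and the indicator of Frobenius and
    Schur, equal to 1, evaluates that of [chi (g ^+ 2)]. *)
Lemma block_avg_squares (S : seq (seq nat)) (c c' : nat -> algC) (y : 'S_k) :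
    all (is_shape m b.+3) S -> uniq S ->
    (forall x, chi (psum x y)
       = \sum_(j < size S) c j * frob (@betaz b.+3 (nth [::] S j)) x) ->
    (forall x, chi (psum x (y ^+ 2)%g)
       = \sum_(j < size S) c' j * frob (@betaz b.+3 (nth [::] S j)) x) ->
  block_avg (sym_square chi) y
    = 2%:R^-1 * (\sum_(j < size S) c j ^+ 2 + \sum_(j < size S) c' j) /\
  block_avg (alt_square chi) y
    = 2%:R^-1 * (\sum_(j < size S) c j ^+ 2 - \sum_(j < size S) c' j).
Proof.
move=> shS uS cE c'E; rewrite -(avg_combination_sqr shS uS cE).
rewrite -(avg_combination_indicator shS c'E) -mulrDr -mulrBr.
rewrite -big_split -sumrB /block_avg !(mulrCA (2%:R^-1)) !mulr_sumr.
by split; apply: eq_bigr => x _;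
  rewrite ?sym_squareE ?alt_squareE ?inE // psum_sqr mulrCA.
Qed.

End Block.

Section Block1.

Variable m : nat.
Hypothesis size_rect : (a * b.+3 = m + 1)%N.
Notation chi := (frob_cfun (m + 1) (@betaz b.+3 rect)).

Lemma rect_block1 :
  block_avg (sym_square chi) 1%g = 1 /\ block_avg (alt_square chi) 1%g = 0.
Proof.
pose S := [:: shape3 a a (a - 1)].
have shS : all (is_shape m b.+3) S by rewrite /= !is_shape3 //; lia.
have E1 x : chi (psum x 1%g) =
    \sum_(j < size S) [:: 1]`_j * frob (@betaz b.+3 (nth [::] S j)) x.
  rewrite rect_psum word_op_S1 ?hook1_rect; try exact: frob_alternating.
  rewrite (@frob_shape3 m x a a (a - 1) (a%:Z - 1) (a%:Z + 1) (a%:Z + 2)); try lia.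
  by rewrite big_ord1 /= mul1r.
have [|-> ->] := block_avg_squares shS isT E1 (c' := nth 0 [:: 1]).
  by rewrite expg1n; apply: E1.
by rewrite !big_ord1 /=; split; field.
Qed.

End Block1.

Section Block2.

Variable m : nat.
Hypothesis size_rect : (a * b.+3 = m + 2)%N.
Notation chi := (frob_cfun (m + 2) (@betaz b.+3 rect)).

Let S := [:: shape3 a a (a - 2); shape3 a (a - 1) (a - 1)].

Let shS : all (is_shape m b.+3) S.
Proof. by rewrite /= !is_shape3 //; lia. Qed.

Let uS : uniq S.
Proof.
rewrite /= inE andbT; apply/eqP=> /eqP; rewrite eqseq_cat // eqxx /= !eqseq_cons.
by case/and4P=> _ /eqP; lia.
Qed.

Lemma rect_psum2_1 x : chi (psum x 1%g) =
  \sum_(j < size S) [:: 1; 1]`_j * frob (@betaz b.+3 (nth [::] S j)) x.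
Proof.
have F_alt := @frob_alternating m b.+3 x; have F1_alt := hook_alternating 1 F_alt.
rewrite rect_psum word_op_S2_1 // hook1_rect // hook1_W //.
rewrite (@frob_shape3 m x a a (a - 2) (a%:Z - 2) (a%:Z + 1) (a%:Z + 2)); try lia.
rewrite (@frob_shape3 m x a (a - 1) (a - 1) (a%:Z - 1) a%:Z (a%:Z + 2)); try lia.
by rewrite !big_ord_recl big_ord0 /=; ring.
Qed.

Lemma rect_psum2_swap x : chi (psum x swap2) =
  \sum_(j < size S) [:: 1; -1]`_j * frob (@betaz b.+3 (nth [::] S j)) x.
Proof.
have F_alt := @frob_alternating m b.+3 x.
rewrite rect_psum word_op_swap2 // hook2_rect //.
rewrite (@frob_shape3 m x a a (a - 2) (a%:Z - 2) (a%:Z + 1) (a%:Z + 2)); try lia.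
rewrite (@frob_shape3 m x a (a - 1) (a - 1) (a%:Z - 1) a%:Z (a%:Z + 2)); try lia.
by rewrite !big_ord_recl big_ord0 /=; ring.
Qed.

Lemma rect_block2 :
  [/\ block_avg (sym_square chi) 1%g = 2%:R, block_avg (alt_square chi) 1%g = 0,
      block_avg (sym_square chi) swap2 = 2%:R & block_avg (alt_square chi) swap2 = 0].
Proof.
have [|-> ->] := block_avg_squares shS uS rect_psum2_1 (c' := nth 0 [:: 1; 1]).
  by rewrite expg1n; apply: rect_psum2_1.
have [|-> ->] := block_avg_squares shS uS rect_psum2_swap (c' := nth 0 [:: 1; 1]).
  by rewrite swap2_sqr; apply: rect_psum2_1.
by rewrite !big_ord_recl !big_ord0 /=; split; field.
Qed.

End Block2.

Section Block3.

Variable m : nat.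
Hypothesis size_rect : (a * b.+3 = m + 3)%N.
Notation chi := (frob_cfun (m + 3) (@betaz b.+3 rect)).

Let S := [:: shape3 a a (a - 3); shape3 a (a - 1) (a - 2);
             shape3 (a - 1) (a - 1) (a - 1)].

Let shS : all (is_shape m b.+3) S.
Proof. by rewrite /= !is_shape3 //; lia. Qed.

Let uS : uniq S.
Proof.
by rewrite /= !inE !eqseq_cat // eqxx /= !eqseq_cons; lia.
Qed.

Lemma rect_psum3_1 x : chi (psum x 1%g) =
  \sum_(j < size S) [:: 1; 2%:R; 1]`_j * frob (@betaz b.+3 (nth [::] S j)) x.
Proof.
have F_alt := @frob_alternating m b.+3 x; have F1_alt := hook_alternating 1 F_alt.
have F11_alt := hook_alternating 1 F1_alt.
rewrite rect_psum word_op_S3_1 // hook1_rect // hook1_W // hook1_U // hook1_V //.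
rewrite (@frob_shape3 m x a a (a - 3) (a%:Z - 3) (a%:Z + 1) (a%:Z + 2)); try lia.
rewrite (@frob_shape3 m x a (a - 1) (a - 2) (a%:Z - 2) a%:Z (a%:Z + 2)); try lia.
rewrite (@frob_shape3 m x (a - 1) (a - 1) (a - 1) (a%:Z - 1) a%:Z (a%:Z + 1)); try lia.
by rewrite !big_ord_recl big_ord0 /=; ring.
Qed.

Lemma rect_psum3_swap x : chi (psum x swap3) =
  \sum_(j < size S) [:: 1; 0; -1]`_j * frob (@betaz b.+3 (nth [::] S j)) x.
Proof.
have F_alt := @frob_alternating m b.+3 x; have F1_alt := hook_alternating 1 F_alt.
rewrite rect_psum word_op_swap3 // hook2_rect // hook1_U // hook1_V //.
rewrite (@frob_shape3 m x a a (a - 3) (a%:Z - 3) (a%:Z + 1) (a%:Z + 2)); try lia.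
rewrite (@frob_shape3 m x a (a - 1) (a - 2) (a%:Z - 2) a%:Z (a%:Z + 2)); try lia.
rewrite (@frob_shape3 m x (a - 1) (a - 1) (a - 1) (a%:Z - 1) a%:Z (a%:Z + 1)); try lia.
by rewrite !big_ord_recl big_ord0 /=; ring.
Qed.

Let cycle_values (y : 'S_3) x :
    word_op y (fun u => @frob m b.+3 u x) (vec a a%:Z (a%:Z + 1) (a%:Z + 2))
      = hook 3 (fun u => @frob m b.+3 u x) (vec a a%:Z (a%:Z + 1) (a%:Z + 2)) ->
  chi (psum x y) =
  \sum_(j < size S) [:: 1; -1; 1]`_j * frob (@betaz b.+3 (nth [::] S j)) x.
Proof.
have F_alt := @frob_alternating m b.+3 x.
rewrite rect_psum => ->; rewrite hook3_rect //.
rewrite (@frob_shape3 m x a a (a - 3) (a%:Z - 3) (a%:Z + 1) (a%:Z + 2)); try lia.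
rewrite (@frob_shape3 m x a (a - 1) (a - 2) (a%:Z - 2) a%:Z (a%:Z + 2)); try lia.
rewrite (@frob_shape3 m x (a - 1) (a - 1) (a - 1) (a%:Z - 1) a%:Z (a%:Z + 1)); try lia.
by rewrite !big_ord_recl big_ord0 /=; ring.
Qed.

(** The restrictions at the identity, at a transposition and at a 3-cycle are
    [P + 2 Q + R], [P - R] and [P - Q + R], where [P], [Q] and [R] are the
    irreducible characters obtained by removing a row of three cells, an angle
    and a column of three cells. *)
Lemma rect_block3 :
  [/\ block_avg (sym_square chi) 1%g = 5%:R,
      block_avg (sym_square chi) swap3 = 3%:R
    & block_avg (sym_square chi) cycle3 = 2%:R] /\
  [/\ block_avg (alt_square chi) 1%g = 1,
      block_avg (alt_square chi) swap3 = -1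
    & block_avg (alt_square chi) cycle3 = 1].
Proof.
have [|-> ->] := block_avg_squares shS uS rect_psum3_1 (c' := nth 0 [:: 1; 2%:R; 1]).
  by rewrite expg1n; apply: rect_psum3_1.
have [|-> ->] := block_avg_squares shS uS rect_psum3_swap (c' := nth 0 [:: 1; 2%:R; 1]).
  by rewrite swap3_sqr; apply: rect_psum3_1.
have [x|x|-> ->] := block_avg_squares (y := cycle3) shS uS
  (c := nth 0 [:: 1; -1; 1]) (c' := nth 0 [:: 1; -1; 1]).
- by apply: cycle_values; apply: word_op_cycle3; apply: frob_alternating.
- by apply: cycle_values; apply: word_op_cycle3_sqr; apply: frob_alternating.
by rewrite !big_ord_recl !big_ord0 /=; split; split; field.
Qed.

End Block3.

End RectangleAverages.

(** * Diagrams with two rows *)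

Section TwoRows.

Variable m : nat.
(* Then the first row remains the longer one when three cells are removed. *)
Hypothesis m_ge6 : (6 <= m)%N.

Definition pair_fun (p r : int) (i : 'I_2) : int := if i == ord0 then p else r.

Definition full_avg (u : 'I_2 -> int) : algC := row_avg [:: m] (@frob m 2 u).

Lemma full_avg_alternating : alternating full_avg.
Proof. exact: row_avg_alternating. Qed.

Lemma betaz_pair p r : @betaz 2 [:: p; r] =1 pair_fun (p%:Z + 1) r%:Z.
Proof.
by move=> [[|[|i]] lt_i] //=; rewrite /betaz /beta /= ?addn0 ?PoszD.
Qed.

(** The average is the multiplicity of the trivial character, whose diagram has
    one row; an entry below 0 gives the zero function. *)
Lemma full_avg_pair (p r : int) : p + r = m%:Z + 1 -> r < p ->
  full_avg (pair_fun p r) = (r == 0)%:R.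
Proof.
move=> sum_pr lt_rp.
have [r_neg|r_ge0] := ltP r 0.
  rewrite lt_eqF // /full_avg; apply: (@row_avg_frob_neg _ _ _ _ ord_max).
  by rewrite /pair_fun.
have [r' def_r] : exists r' : nat, r = r'%:Z by exists `|r|%N; lia.
have [p' def_p] : exists p' : nat, p = p'%:Z + 1 by exists `|p - 1|%N; lia.
rewrite def_r def_p; have [r0|r_neq0] := eqVneq r' 0%N; last first.
  rewrite eqz_nat (negbTE r_neq0); apply/eqP/contraT=> nz.
  have sort_pr : sorted geq [:: p'; r'] by rewrite /= andbT; lia.
  have sum_m : sumn [:: m] = m by rewrite /= addn0.
  have nz' : row_avg [:: m] (@frob m 2 (@betaz 2 [:: p'; r'])) != 0.
    by rewrite ((row_avg_alternating _ _ _).1 _ _ (betaz_pair p' r')).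
  have := row_avg_cells sum_m sort_pr (leqnn 2) nz' 1.
  by rewrite /cells !big_cons !big_nil; lia.
rewrite r0 eqxx -(@row_avg_frob_diagE m 2 [:: m]) /= ?addn0 //.
apply: (row_avg_alternating _ _ _).1 => i; rewrite -betaz_pair /betaz.
have -> : p' = m by lia.
by case: i => -[|[|i]] lt_i.
Qed.

Lemma hook_pair k (G : ('I_2 -> int) -> algC) p r : alternating G ->
  hook k G (pair_fun p r) = G (pair_fun (p - k%:Z) r) + G (pair_fun p (r - k%:Z)).
Proof.
move=> G_alt; rewrite /hook !big_ord_recl big_ord0 addr0.
by congr (_ + _); apply: G_alt.1 => -[[|[|i]] lt_i] //;
  rewrite /pair_fun -!val_eqE /= ?mul1n ?mul0n ?subr0.
Qed.

Lemma block_avg_pair k (y : 'S_k) p r :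
  block_avg (frob_cfun (m + k) (@betaz 2 [:: p; r])) y
    = word_op y full_avg (pair_fun (p%:Z + 1) r%:Z).
Proof.
rewrite /block_avg; under eq_bigr do rewrite frob_cfunE frob_psum.
rewrite exchange_big mulr_sumr; apply: eq_bigr => d _.
rewrite -row_avg_row; apply: (row_avg_alternating _ _ _).1 => i.
by rewrite betaz_pair.
Qed.

Let F_alt := full_avg_alternating.
Let F1_alt := hook_alternating 1 F_alt.
Let F11_alt := hook_alternating 1 F1_alt.

Let row2E : ((2%:Z == 0) = false) * ((2%:Z - 1%:Z == 0) = false)
  * ((2%:Z - 1%:Z - 1%:Z == 0) = true)
  * ((2%:Z - 1%:Z - 1%:Z - 1%:Z == 0) = false)
  * ((2%:Z - 2%:Z == 0) = true) * ((2%:Z - 2%:Z - 1%:Z == 0) = false)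
  * ((2%:Z - 3%:Z == 0) = false).
Proof. by []. Qed.

Lemma two_rows_2_column :
  row_avg [:: m; 1%N; 1%N] (frob_cfun (m + 2) (@betaz 2 [:: m; 2%N])) = 1.
Proof.
rewrite row_avg_block (@row_avg_column 2) block_avg_pair word_op_S2_1 //.
rewrite !hook_pair //.
by rewrite !full_avg_pair; try lia; rewrite !row2E /=; ring.
Qed.

Lemma two_rows_3 (phi := frob_cfun (m + 3) (@betaz 2 [:: m.+1; 2%N])) :
  [/\ row_avg [:: m; 3%N] phi = 1, row_avg [:: m; 2%N; 1%N] phi = 2%:R
    & row_avg [:: m; 1%N; 1%N; 1%N] phi = 3%:R].
Proof.
have phiJ := block_avgJ (cfunJ_Sn phi).
have phi1 : block_avg phi 1%g = 3%:R.
  rewrite block_avg_pair word_op_S3_1 // !hook_pair //.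
  by rewrite !full_avg_pair; try lia; rewrite !row2E /=; ring.
have phi_swap : block_avg phi swap3 = 1.
  rewrite block_avg_pair word_op_swap3 // !hook_pair //.
  by rewrite !full_avg_pair; try lia; rewrite !row2E /=; ring.
have phi_cycle : block_avg phi cycle3 = 0.
  rewrite block_avg_pair word_op_cycle3 // !hook_pair //.
  by rewrite !full_avg_pair; try lia; rewrite !row2E /=; ring.
rewrite !row_avg_block row_avg_S3 // row_avg_S21 // (@row_avg_column 3).
by rewrite phi1 phi_swap phi_cycle; split; field.
Qed.

Let row3E : ((3%:Z == 0) = false) * ((3%:Z - 1%:Z == 0) = false)
  * ((3%:Z - 1%:Z - 1%:Z == 0) = false)
  * ((3%:Z - 1%:Z - 1%:Z - 1%:Z == 0) = true)
  * ((3%:Z - 2%:Z == 0) = false) * ((3%:Z - 2%:Z - 1%:Z == 0) = true).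
Proof. by []. Qed.

Lemma three_rows_3 (phi := frob_cfun (m + 3) (@betaz 2 [:: m; 3%N])) :
  row_avg [:: m; 2%N; 1%N] phi = 1 /\ row_avg [:: m; 1%N; 1%N; 1%N] phi = 1.
Proof.
have phiJ := block_avgJ (cfunJ_Sn phi).
have phi1 : block_avg phi 1%g = 1.
  rewrite block_avg_pair word_op_S3_1 // !hook_pair //.
  by rewrite !full_avg_pair; try lia; rewrite !row3E /=; ring.
have phi_swap : block_avg phi swap3 = 1.
  rewrite block_avg_pair word_op_swap3 // !hook_pair //.
  by rewrite !full_avg_pair; try lia; rewrite !row3E /=; ring.
rewrite !row_avg_block row_avg_S21 // (@row_avg_column 3).
by rewrite phi1 phi_swap; split; field.
Qed.

End TwoRows.

(** * Linear equations for the multiplicities *)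

Section RectangleEquations.

Variables (n a b : nat).
Hypotheses (a_ge3 : (3 <= a)%N) (size_rect : (a * b.+3 = n)%N).

Notation chi := (frob_cfun n (@betaz b.+3 (nseq b.+3 a))).

Lemma is_shape_rect : is_shape n b.+3 (nseq b.+3 a).
Proof.
apply/and3P; rewrite sumn_nseq size_nseq size_rect; split=> //.
have path_a k : path geq a (nseq k a) by elim: k => //= k ->; rewrite leqnn.
exact: (path_a b.+2).
Qed.

Lemma rect_equation0 :
  row_avg [:: n] (sym_square chi) = 1 /\ row_avg [:: n] (alt_square chi) = 0.
Proof.
have shS : all (is_shape n b.+3) [:: nseq b.+3 a] by rewrite /= is_shape_rect.
have E x : chi x = \sum_(j < 1) [:: 1]`_j * frob (@betaz b.+3 (nth [::] [:: nseq b.+3 a] j)) x.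
  by rewrite big_ord1 /= mul1r frob_cfunE.
have := avg_combination_sqr shS isT E; have := avg_combination_indicator shS E.
rewrite !big_ord1 /= expr1n !row_avg_row => ind sqr.
rewrite (eq_bigr _ (fun g _ => sym_squareE chi (in_setT g))).
rewrite [in X in _ /\ X](eq_bigr _ (fun g _ => alt_squareE chi (in_setT g))).
rewrite -!mulr_sumr big_split sumrB /= !(mulrCA _ (2%:R^-1)) mulrDr mulrBr ind sqr.
by split; field.
Qed.

Lemma rect_equation1 :
  row_avg [:: (n - 1)%N; 1%N] (sym_square chi) = 1 /\
  row_avg [:: (n - 1)%N; 1%N] (alt_square chi) = 0.
Proof.
have [m def_n] : exists m, n = (m + 1)%N by exists (n - 1)%N; lia.
move: size_rect; rewrite def_n addnK => size_m.
by rewrite !row_avg_block !(@row_avg_column 1); apply: rect_block1.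
Qed.

Lemma rect_equations2 :
  [/\ row_avg [:: (n - 2)%N; 2%N] (sym_square chi) = 2%:R,
      row_avg [:: (n - 2)%N; 1%N; 1%N] (sym_square chi) = 2%:R,
      row_avg [:: (n - 2)%N; 2%N] (alt_square chi) = 0
    & row_avg [:: (n - 2)%N; 1%N; 1%N] (alt_square chi) = 0].
Proof.
have [m def_n] : exists m, n = (m + 2)%N by exists (n - 2)%N; lia.
move: size_rect; rewrite def_n addnK => size_m.
rewrite !row_avg_block !(@row_avg_column 2) !row_avg_S2.
have [-> -> -> ->] := rect_block2 a_ge3 size_m.
by split; field.
Qed.

Lemma rect_equations3 :
  [/\ row_avg [:: (n - 3)%N; 3%N] (sym_square chi) = 3%:R,
      row_avg [:: (n - 3)%N; 2%N; 1%N] (sym_square chi) = 4%:R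
    & row_avg [:: (n - 3)%N; 1%N; 1%N; 1%N] (sym_square chi) = 5%:R] /\
  [/\ row_avg [:: (n - 3)%N; 3%N] (alt_square chi) = 0,
      row_avg [:: (n - 3)%N; 2%N; 1%N] (alt_square chi) = 0
    & row_avg [:: (n - 3)%N; 1%N; 1%N; 1%N] (alt_square chi) = 1].
Proof.
have [m def_n] : exists m, n = (m + 3)%N by exists (n - 3)%N; lia.
move: size_rect; rewrite def_n addnK => size_m.
rewrite !row_avg_block !(@row_avg_column 3).
rewrite !row_avg_S3 ?row_avg_S21; try by apply: block_avgJ; apply: cfunJ_Sn.
have [[-> -> ->] [-> -> ->]] := rect_block3 a_ge3 size_m.
by split; split; field.
Qed.

End RectangleEquations.

Definition small_shapes n : seq (seq nat) :=
  [:: [:: n]; [:: (n - 1)%N; 1%N]; [:: (n - 2)%N; 2%N]; [:: (n - 2)%N; 1%N; 1%N];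
      [:: (n - 3)%N; 3%N]; [:: (n - 3)%N; 2%N; 1%N];
      [:: (n - 3)%N; 1%N; 1%N; 1%N]].

Section Decomposition.

Variable n : nat.
Hypothesis n_ge9 : (9 <= n)%N.
Notation Sn := [set: 'S_n].

Lemma small_shapes_partition : all (is_partition n) (small_shapes n).
Proof. by rewrite /is_partition /= !inE; lia. Qed.

Lemma small_shapes_uniq : uniq (small_shapes n).
Proof. by rewrite /= !inE !eqseq_cons; lia. Qed.

Lemma depth_small nu : is_partition n nu -> nu \notin small_shapes n ->
  (4 <= depth n nu)%N.
Proof.
case/is_partitionP=> sort_nu pos_nu sum_nu; apply: contraR; rewrite -ltnNge.
rewrite /depth; case: nu sort_nu pos_nu sum_nu => [|x nu] /=; first by lia.
case: nu => [|y nu] /=; first by rewrite !inE !eqseq_cons ?eqxx; lia.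
case: nu => [|z nu] /=; first by rewrite !inE !eqseq_cons ?eqxx; lia.
case: nu => [|w nu] /=; first by rewrite !inE !eqseq_cons ?eqxx; lia.
case: nu => [|u nu] /=; first by rewrite !inE !eqseq_cons ?eqxx; lia.
by lia.
Qed.

(** By dominance, the first row of [nu] would be at least as long as that of
    [mu]. *)
Lemma row_avg_deep mu nu : mu \in small_shapes n -> is_partition n nu ->
  (4 <= depth n nu)%N -> row_avg mu (specht_char n nu) = 0.
Proof.
move=> small_mu part_nu deep; apply/eqP/contraT=> nz.
have [sort_nu pos_nu sum_nu] := is_partitionP part_nu.
have [_ _ sum_mu] := is_partitionP (allP small_shapes_partition _ small_mu).
have nz' : row_avg mu (@frob n _ (@betaz (size nu) nu)) != 0.
  by rewrite -(eq_row_avg _ (frob_cfunE _)) -specht_frob.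
have := row_avg_cells sum_mu sort_nu (leqnn _) nz' (head 0%N nu).
have -> : cells (head 0%N nu) nu = n.
  rewrite /cells -[RHS]sum_nu sumnE; apply: eq_big_seq => x nu_x.
  apply/minn_idPl; case: nu sort_nu nu_x {pos_nu sum_nu part_nu deep nz nz'} => //= y s.
  move=> sort_s; rewrite inE => /predU1P [-> //|s_x].
  have tr : transitive geq by move=> p q r /= ? ?; apply: leq_trans; eauto.
  by have /allP := order_path_min tr sort_s; apply.
move: deep; rewrite /depth /cells; move: (head 0%N nu) => h.
move: small_mu; rewrite !inE => /or4P [|||/or4P []] /eqP ->;
  rewrite !big_cons big_nil; lia.
Qed.

(** Group the irreducible constituents of [phi] by depth.  Those of depth at
    least 4 do not contribute to the averages over the row stabilisers of the
    seven shapes of smaller depth. *)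
Lemma small_decomposition (phi : 'CF(Sn)) : phi \is a character ->
  exists M : seq nat -> nat, exists2 rest, sum_of_depth_ge 4 rest &
    [/\ phi = \sum_(nu <- small_shapes n) (M nu)%:R *: specht_char n nu + rest
      & forall mu, mu \in small_shapes n -> row_avg mu phi =
          \sum_(nu <- small_shapes n) (M nu)%:R * row_avg mu (specht_char n nu)].
Proof.
move=> char_phi.
have [nu part_nu def_nu] : exists2 nu : Iirr Sn -> seq nat,
    forall i, is_partition n (nu i) & forall i, 'chi_i = specht_char n (nu i).
  have /fin_all_exists2 [nu] : forall i : Iirr Sn,
     exists2 la, is_partition n la & 'chi_i = specht_char n la.
    exact: irr_specht.
  by exists nu.
have nu_inj : injective nu.
  by move=> i j eq_nu; apply: irr_inj; rewrite !def_nu eq_nu.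
pose M la := Num.truncn '[phi, specht_char n la].
have ME i : '[phi, 'chi_i] = (M (nu i))%:R.
  by rewrite /M -def_nu truncnK // Cnat_cfdot_char_irr.
pose G la := (M la)%:R *: specht_char n la.
have phiE : phi = \sum_i G (nu i).
  rewrite [LHS]cfun_sum_cfdot; apply: eq_bigr => i _.
  by rewrite ME def_nu.
have nu_surj la : is_partition n la -> exists i, la = nu i.
  move=> part_la; have [_ _ sum_la] := is_partitionP part_la.
  have [i [def_i _ _]] := specht_constt n la; exists i.
  by apply: (@specht_inj n) => //; rewrite def_i def_nu.
have phiE2 : phi = \sum_(la <- small_shapes n) G la
                   + \sum_(i | nu i \notin small_shapes n) G (nu i).
  rewrite {1}phiE (bigID (fun i => nu i \in small_shapes n)) /=; congr (_ + _).
  rewrite -big_filter -(big_map nu xpredT).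
  apply: perm_big; apply: uniq_perm; first by rewrite map_inj_uniq ?filter_uniq ?index_enum_uniq.
    exact: small_shapes_uniq.
  move=> la; apply/mapP/idP=> [[i]|small_la].
    by rewrite mem_filter => /andP [small_i _] ->.
  have [i def_la] := nu_surj la (allP small_shapes_partition _ small_la).
  by exists i; rewrite // mem_filter -def_la small_la mem_index_enum.
exists M, (\sum_(i | nu i \notin small_shapes n) G (nu i)).
  exists (flatten [seq nseq (M (nu i)) (nu i) | i <- index_enum (Iirr Sn)
                                              & nu i \notin small_shapes n]).
    apply/allP=> la /flattenP [s /mapP [i]]; rewrite mem_filter => /andP [ns _] ->.
    by move=> /nseqP [-> _]; rewrite part_nu depth_small.
  rewrite big_flatten big_map big_filter; apply: eq_bigr => i _.
  by rewrite big_nseq iter_addr_0 /G scaler_nat.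
split=> // mu small_mu; rewrite {1}phiE2 row_avg_cfdot cfdotDl !cfdot_suml.
rewrite [X in _ + X]big1 ?addr0 => [|i /depth_small deep]; last first.
  rewrite cfdotZl -row_avg_cfdot row_avg_deep ?mulr0 //.
  exact: deep.
by apply: eq_bigr => la _; rewrite cfdotZl -row_avg_cfdot.
Qed.

End Decomposition.

(** * Solution of the equations *)

Section Solve.

Variable n : nat.
Hypothesis n_ge9 : (9 <= n)%N.

Notation s0 := [:: n].
Notation s1 := [:: (n - 1)%N; 1%N].
Notation s2 := [:: (n - 2)%N; 2%N].
Notation s11 := [:: (n - 2)%N; 1%N; 1%N].
Notation s3 := [:: (n - 3)%N; 3%N].
Notation s21 := [:: (n - 3)%N; 2%N; 1%N].
Notation s111 := [:: (n - 3)%N; 1%N; 1%N; 1%N].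

Definition kostka (mu la : seq nat) : nat :=
  Num.truncn (row_avg mu (specht_char n la)).

Lemma kostkaE mu la : (kostka mu la)%:R = row_avg mu (specht_char n la).
Proof.
rewrite /kostka truncnK //; have [i [-> _ _]] := specht_constt n la.
exact: row_avg_char_nat.
Qed.

Lemma kostka_frob mu la : is_partition n la ->
  (kostka mu la)%:R = row_avg mu (@frob n _ (@betaz (size la) la)).
Proof.
by move=> part_la; rewrite kostkaE specht_frob // (eq_row_avg _ (frob_cfunE _)).
Qed.

Lemma kostka_self la : is_partition n la -> kostka la la = 1%N.
Proof.
move=> part_la; have [sort_la _ sum_la] := is_partitionP part_la.
by apply/eqP; rewrite -(eqr_nat algC) kostka_frob // row_avg_frob_diagE.
Qed.

Lemma kostka_eq0 k mu la : is_partition n la -> sumn mu = n ->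
  (cells k mu < cells k la)%N -> kostka mu la = 0%N.
Proof.
move=> part_la sum_mu lt_k; have [sort_la _ _] := is_partitionP part_la.
apply/eqP; rewrite -(eqr_nat algC) kostka_frob //; apply/contraT=> nz.
by have := row_avg_cells sum_mu sort_la (leqnn _) nz k; rewrite leqNgt lt_k.
Qed.

Lemma kostka_trivial mu : kostka mu s0 = 1%N.
Proof.
apply/eqP; rewrite -(eqr_nat algC) kostkaE.
have part0 : is_partition n s0 by rewrite /is_partition /= !inE; lia.
have := kostka_self part0; move/(congr1 (fun k => k%:R : algC)).
have [i [def_i _ _]] := specht_constt n s0.
rewrite kostkaE def_i row_avg_row => avg1.
have dot1 : '['chi_i, 1] = 1.
  rewrite cfdot_Sn -[RHS]avg1; congr (_ * _); apply: eq_bigr => g _.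
  by rewrite cfun1E inE rmorph1 mulr1.
have -> : 'chi_i = 1.
  move: dot1; rewrite -irr0 cfdot_irr; have [->|_] := eqVneq i 0 => //.
  by move/eqP; rewrite eq_sym oner_eq0.
apply/eqP; apply: etrans (@row_avg_const n mu 1); apply: eq_row_avg => g.
by rewrite cfun1E inE.
Qed.

(** Removing rim hooks from a diagram with two rows gives the averages over the
    first block, see [two_rows_2_column], [two_rows_3] and [three_rows_3]. *)
Lemma kostka_two_rows :
  [/\ kostka s11 s2 = 1%N, kostka s3 s2 = 1%N, kostka s21 s2 = 2%N
    & kostka s111 s2 = 3%N] /\ kostka s21 s3 = 1%N /\ kostka s111 s3 = 1%N.
Proof.
have shapes := allP (small_shapes_partition n_ge9).
have part2 : is_partition n s2 by apply: shapes; rewrite !inE eqxx !orbT.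
have part3 : is_partition n s3 by apply: shapes; rewrite !inE eqxx !orbT.
have natE (x y : nat) : x%:R = y%:R :> algC -> x = y.
  by move/eqP; rewrite eqr_nat => /eqP.
have K11 : kostka s11 s2 = 1%N.
  apply: natE; rewrite kostkaE specht_frob //; clear shapes part2 part3.
  have [m def_n] : exists m, n = (m + 2)%N by exists (n - 2)%N; lia.
  by rewrite def_n addnK two_rows_2_column //; lia.
have [m def_n] : exists m, n = (m + 3)%N by exists (n - 3)%N; lia.
have m_ge6 : (6 <= m)%N by lia.
have [K1 K2 K3] := two_rows_3 m_ge6; have [K4 K5] := three_rows_3 m_ge6.
have n3 : (n - 3 = m)%N by lia.
have n2 : (n - 2 = m.+1)%N by lia.
split; [split=> //|split]; apply: natE; rewrite kostkaE specht_frob // ?n3 ?n2.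
- by rewrite def_n K1.
- by rewrite def_n K2.
- by rewrite def_n K3.
- by rewrite def_n K4.
by rewrite def_n K5.
Qed.

Let zero k mu la : la \in small_shapes n -> mu \in small_shapes n ->
  (cells k mu < cells k la)%N -> kostka mu la = 0%N.
Proof.
move=> small_la small_mu; apply: kostka_eq0.
  exact: (allP (small_shapes_partition n_ge9)).
by have [] := is_partitionP (allP (small_shapes_partition n_ge9) _ small_mu).
Qed.

Ltac kostka_zero k := apply: (@zero k);
  rewrite ?inE ?eqxx ?orbT // /cells !big_cons !big_nil; lia.

Lemma kostka_zeros0 :
  [/\ kostka s0 s1 = 0, kostka s0 s2 = 0 & kostka s0 s11 = 0]%N /\
  [/\ kostka s0 s3 = 0, kostka s0 s21 = 0 & kostka s0 s111 = 0]%N.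
Proof. by split; split; kostka_zero 1%N. Qed.

Lemma kostka_zeros2 :
  [/\ kostka s2 s11 = 0, kostka s2 s3 = 0, kostka s2 s21 = 0
    & kostka s2 s111 = 0]%N.
Proof. by split; [kostka_zero 1%N | kostka_zero 3%N | kostka_zero 1%N | kostka_zero 1%N]. Qed.

Lemma kostka_zeros3 : kostka s3 s21 = 0%N /\ kostka s3 s111 = 0%N.
Proof. by split; kostka_zero 1%N. Qed.

Lemma multiplicity_equation (phi : 'CF([set: 'S_n])) M mu e :
    row_avg mu phi =
      \sum_(nu <- small_shapes n) (M nu)%:R * row_avg mu (specht_char n nu) ->
    row_avg mu phi = e%:R ->
  (\sum_(nu <- small_shapes n) M nu * kostka mu nu = e)%N.
Proof.
move=> -> def_e; apply/eqP; rewrite -(eqr_nat algC) -def_e natr_sum.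
by apply/eqP/eq_bigr => nu _; rewrite natrM kostkaE.
Qed.

End Solve.

(** The system is triangular along dominance; the coefficients that are left
    indeterminate are multiplied by unknowns already known to vanish, or occur
    in an equation which is saturated by its known terms. *)
Lemma solve_kostka_system (x0 x1 x2 x11 x3 x21 x111 : nat)
    (p1 p2 p3 p4 p5 q1 q2 q3 q4 r1 r2 u1 u2 u3 t1 v1 v2 v3 : nat) :
    (x0 = 1)%N ->
    (x0 + (x1 + (x2 * p1 + (x11 * p2 + (x3 * p3 + (x21 * p4 + x111 * p5))))) = 1)%N ->
    (x0 + (x1 * q1 + x2) = 2)%N ->
    (x0 + (x1 * q2 + (x2 + (x11 + (x3 * q3 + (x21 * q4 + x111 * r1))))) = 2)%N ->
    (x0 + (x1 * r2 + (x2 + (x11 * u1 + x3))) = 3)%N ->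
    (x0 + (x1 * u2 + (x2 * 2 + (x11 * u3 + (x3 + (x21 + x111 * t1))))) = 4)%N ->
    (x0 + (x1 * v1 + (x2 * 3 + (x11 * v2 + (x3 + (x21 * v3 + x111))))) = 5)%N ->
  [/\ x1 = 0, x2 = 1, x11 = 0 & x3 = 1]%N /\ x21 = 0%N /\ x111 = 0%N.
Proof.
move=> -> e1 e2 e11 e3 e21 e111.
have x1_0 : x1 = 0%N by clear - e1; lia.
subst x1; rewrite !mul0n in e2 e11 e3 e21 e111.
have x2_1 : x2 = 1%N by clear - e2; lia.
subst x2; have x11_0 : x11 = 0%N by clear - e11; lia.
subst x11; rewrite !mul0n in e3 e21 e111.
have x3_1 : x3 = 1%N by clear - e3; lia.
subst x3; have x21_0 : x21 = 0%N by clear - e21; lia.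
subst x21; have x111_0 : x111 = 0%N by clear - e111; lia.
by [].
Qed.

Section Multiplicities.

Variables (n a b : nat).
Hypotheses (a_ge3 : (3 <= a)%N) (size_rect : (a * b.+3 = n)%N).

Notation chi := (specht_char n (nseq b.+3 a)).

Let n_ge9 : (9 <= n)%N. Proof. by nia. Qed.

Let rect_partition : is_partition n (nseq b.+3 a).
Proof.
have /and3P [sort_r /eqP sum_r _] := is_shape_rect size_rect.
apply/and3P; split=> //; last by rewrite sum_r.
by rewrite mem_nseq; lia.
Qed.

Let chiE : chi = frob_cfun n (@betaz b.+3 (nseq b.+3 a)).
Proof. by rewrite specht_frob // size_nseq. Qed.

Let chi_char : chi \is a character.
Proof. by have [i [-> _ _]] := specht_constt n (nseq b.+3 a); apply: irr_char. Qed.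

(** The equation at a shape bounds the multiplicity of that shape.  Six of the
    equations have right-hand side 0, and the last one has right-hand side 1. *)
Lemma alt_square_rect : exists2 psi, sum_of_depth_ge 4 psi &
  alt_square chi = specht_char n [:: (n - 3)%N; 1%N; 1%N; 1%N] + psi.
Proof.
have [M [psi deep [decomp eqs]]] :=
  small_decomposition n_ge9 (alt_square_char chi_char).
exists psi => //; rewrite decomp; congr (_ + _).
have eq_at mu e : mu \in small_shapes n -> row_avg mu (alt_square chi) = e%:R ->
    (\sum_(nu <- small_shapes n) M nu * kostka n mu nu = e)%N.
  by move=> /eqs; apply: multiplicity_equation.
have M_eq0 mu : mu \in small_shapes n -> row_avg mu (alt_square chi) = 0 ->
    M mu = 0%N.
  move=> small_mu /(eq_at _ 0%N small_mu) /eqP.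
  rewrite (big_rem mu) //= addn_eq0 kostka_self ?muln1 => [/andP [/eqP //]|].
  exact: (allP (small_shapes_partition n_ge9)).
have [_ E0] := rect_equation0 size_rect.
have [_ E1] := rect_equation1 a_ge3 size_rect.
have [_ _ E2 E11] := rect_equations2 a_ge3 size_rect.
have [_ [E3 E21 E111]] := rect_equations3 a_ge3 size_rect.
rewrite -chiE in E0 E1 E2 E11 E3 E21 E111.
have small j : (j < 7)%N -> nth [::] (small_shapes n) j \in small_shapes n.
  by move=> lt_j; apply: mem_nth.
have e111 := eq_at _ 1%N (small 6%N isT) E111.
move: e111; rewrite /small_shapes !big_cons !big_nil.
rewrite (M_eq0 _ (small 0%N isT) E0) (M_eq0 _ (small 1%N isT) E1).
rewrite (M_eq0 _ (small 2%N isT) E2) (M_eq0 _ (small 3%N isT) E11).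
rewrite (M_eq0 _ (small 4%N isT) E3) (M_eq0 _ (small 5%N isT) E21).
rewrite !mul0n !add0n !addn0 kostka_self; last first.
  exact: (allP (small_shapes_partition n_ge9) _ (small 6%N isT)).
by rewrite muln1 => ->; rewrite !scale0r scale1r !add0r addr0.
Qed.

Lemma sym_square_rect : exists2 phi, sum_of_depth_ge 4 phi &
  sym_square chi = specht_char n [:: n] + specht_char n [:: (n - 2)%N; 2%N]
                   + specht_char n [:: (n - 3)%N; 3%N] + phi.
Proof.
have [M [phi deep [decomp eqs]]] :=
  small_decomposition n_ge9 (sym_square_char chi_char).
exists phi => //; rewrite decomp; congr (_ + _).
have eq_at mu e : mu \in small_shapes n -> row_avg mu (sym_square chi) = e%:R ->
    (\sum_(nu <- small_shapes n) M nu * kostka n mu nu = e)%N.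
  by move=> /eqs; apply: multiplicity_equation.
have [E0 _] := rect_equation0 size_rect.
have [E1 _] := rect_equation1 a_ge3 size_rect.
have [E2 E11 _ _] := rect_equations2 a_ge3 size_rect.
have [[E3 E21 E111] _] := rect_equations3 a_ge3 size_rect.
rewrite -chiE in E0 E1 E2 E11 E3 E21 E111.
have small j : (j < 7)%N -> nth [::] (small_shapes n) j \in small_shapes n.
  by move=> lt_j; apply: mem_nth.
have self j (lt_j : (j < 7)%N) :=
  kostka_self (allP (small_shapes_partition n_ge9) _ (small j lt_j)).
have := eq_at _ 5%N (small 6%N isT) E111; have := eq_at _ 4%N (small 5%N isT) E21.
have := eq_at _ 3%N (small 4%N isT) E3; have := eq_at _ 2%N (small 3%N isT) E11.
have := eq_at _ 2%N (small 2%N isT) E2; have := eq_at _ 1%N (small 1%N isT) E1.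
have := eq_at _ 1%N (small 0%N isT) E0.
rewrite /small_shapes !big_cons !big_nil /= !kostka_trivial //.
rewrite (self 1%N isT) (self 2%N isT) (self 3%N isT) (self 4%N isT).
rewrite (self 5%N isT) (self 6%N isT) /=.
have [[-> -> -> ->] [-> ->]] := kostka_two_rows n_ge9.
have [[-> -> ->] [-> -> ->]] := kostka_zeros0 n_ge9.
have [-> -> -> ->] := kostka_zeros2 n_ge9; have [-> ->] := kostka_zeros3 n_ge9.
move: (M _) (M _) (M _) (M _) (M _) (M _) (M _) => x111 x21 x3 x11 x2 x1 x0.
do 18!move: (kostka _ _ _) => ?.
rewrite !muln0 !muln1 !addn0 => M0 e1 e2 e11 e3 e21 e111.
have [[-> -> -> ->] [-> ->]] := solve_kostka_system M0 e1 e2 e11 e3 e21 e111.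
by rewrite M0 !scale0r !scale1r !add0r !addr0 addrA.
Qed.

End Multiplicities.

Theorem proposition5p3 (a b : nat) (ha : (3 <= a)%N) (hb : (3 <= b)%N) :
  let n := (a * b)%N in
  let chi := specht_char n (nseq b a) in
  (exists2 phi : 'CF([set: 'S_n]), sum_of_depth_ge 4 phi &
     sym_square chi =
       specht_char n [:: n] + specht_char n [:: (n - 2)%N; 2%N]
       + specht_char n [:: (n - 3)%N; 3%N] + phi)
  /\
  (exists2 psi : 'CF([set: 'S_n]), sum_of_depth_ge 4 psi &
     alt_square chi =
       specht_char n [:: (n - 3)%N; 1%N; 1%N; 1%N] + psi).
Proof.
case: b hb => [|[|[|b]]] // _ n chi.
by split; [apply: sym_square_rect | apply: alt_square_rect].
Qed.
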